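(* Let $\Gamma_\sigma$ be the frozen Jacobian algebra associated with a triangulation $\sigma$ of a polygon $P$ with $n\ge 3$ vertices (see context). Then $\Gamma_\sigma$ has the structure of a tiled $R$-order, where $R=K[x]$: there is an $R$-algebra structure on $\Gamma_\sigma$ under which $\Gamma_\sigma$ is isomorphic, as an $R$-algebra, to a tiled $R$-order.
   Context: Let $K$ be a field and $R=K[x]$. Let $P$ be a regular polygon with $n\ge3$ vertices $P_1,\dots,P_n$ labelled counterclockwise. A diagonal is a segment joining two vertices of $P$ and lying in the interior of $P$; two diagonals cross if they share an interior point. A triangulation $\sigma$ of $P$ is a decomposition of $P$ into triangles by a maximal set of pairwise non-crossing diagonals; its edges are the $n$ sides of $P$ and its diagonals. The quiver $Q_\sigma$ has as vertices the edges of $\sigma$. Whenever two edges $a,b$ are sides of a common triangle of $\sigma$, there is an internal arrow $a\to b$ if $a$ is a predecessor of $b$ with respect to anticlockwise orientation centered at their common vertex. For every vertex of $P$ incident to at least one diagonal of $\sigma$ there is an external arrow $a\to b$, where $a,b$ are the two sides of $P$ at that vertex and $a$ precedes $b$ anticlockwise around the vertex. A minimal cycle of $Q_\sigma$ is a cycle in which no arrow appears twice and which encloses a region of the plane whose interior is connected and contains no arrow; these are the cyclic triangles (three internal arrows inside a triangle of $\sigma$) and the big cycles (internal arrows and one external arrow around a vertex of $P$). Put $W_\sigma=\sum(\text{cyclic triangles})-\sum(\text{big cycles})$ and let $F$ be the set of vertices of $Q_\sigma$ corresponding to the sides of $P$ (frozen vertices). For an arrow $a$, the cyclic derivative is the linear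 map with $\partial_a(a_1\cdots a_d)=\sum_{a_i=a}a_{i+1}\cdots a_da_1\cdots a_{i-1}$ on cycles. The frozen Jacobian algebra is $\Gamma_\sigma=KQ_\sigma/J$, where $J$ is the two-sided ideal generated by $\partial_aW_\sigma$ for all arrows $a$ with source or target not in $F$. An $R$-order is an $R$-algebra which is finitely generated and free as an $R$-module. A tiled $R$-order is an $R$-subalgebra of $M_m(K(x))$ of the form $((x^{a_{ij}}R))_{i,j=1}^m$ (the $(i,j)$ entries range over $x^{a_{ij}}R$) with $a_{ij}\in\mathbb Z$ satisfying $a_{ij}+a_{jt}\ge a_{it}$ for all $i,j,t$. *)

(* Defs.v *)
From HB Require Import structures.
From mathcomp Require Import all_boot all_order all_algebra.
From mathcomp Require Import fraction.
Set Implicit Arguments. Unset Strict Implicit. Unset Printing Implicit Defensive.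
Import Order.TTheory GRing.Theory Num.Theory.
Local Open Scope ring_scope.

(* Polygon combinatorics.  Vertices of P are P_0,...,P_{n-1} ('I_n),   *)
(* labelled counterclockwise.  A segment {P_i,P_j} is encoded by the   *)
(* ordered pair (i,j) with i < j.                                      *)
Section Polygon.
Variable n : nat.
Local Notation V := ('I_n * 'I_n)%type.

Definition seg (i j : 'I_n) : V := if (i < j)%N then (i, j) else (j, i).

Definition is_side (x : V) : bool :=
  (x.1 < x.2)%N && ((x.1.+1 %% n == x.2)%N || (x.2.+1 %% n == x.1)%N).

Definition is_diag (x : V) : bool :=
  (x.1 < x.2)%N && ~~ ((x.1.+1 %% n == x.2)%N || (x.2.+1 %% n == x.1)%N).

Definition cross (d d' : V) : bool :=
  ((d.1 < d'.1)%N && (d'.1 < d.2)%N && (d.2 < d'.2)%N) ||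
  ((d'.1 < d.1)%N && (d.1 < d'.2)%N && (d'.2 < d.2)%N).

Definition triangulation (s : {set V}) : Prop :=
  [/\ {subset s <= is_diag},
      (forall d d', d \in s -> d' \in s -> ~~ cross d d') &
      (forall d, is_diag d -> d \notin s -> exists2 d', d' \in s & cross d d')].

Variable s : {set V}.

(* edges of sigma = vertices of Q_sigma *)
Definition is_edge (x : V) : bool := is_side x || (x \in s).

(* position of P_j in the anticlockwise order of directions around P_i:
   P_{i+1}, P_{i+2}, ..., P_{i-1} *)
Definition rot (i j : 'I_n) : nat := ((j + n - i) %% n)%N.

Definition is_tri (i j k : 'I_n) : bool :=
  [&& i != j, j != k, i != k, is_edge (seg i j), is_edge (seg j k)
    & is_edge (seg i k)].

Definition has_diag (i : 'I_n) : bool :=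
  [exists d in s, (d.1 == i) || (d.2 == i)].

Definition int_arrow (a b : V) : bool :=
  [exists i : 'I_n, exists j : 'I_n, exists k : 'I_n,
    [&& is_tri i j k, a == seg i j, b == seg i k & (rot i j < rot i k)%N]].

Definition ext_arrow (a b : V) : bool :=
  [exists i : 'I_n, exists h : 'I_n, exists j : 'I_n,
    [&& has_diag i, (h.+1 %% n == i)%N, (i.+1 %% n == j)%N,
        a == seg h i & b == seg i j]].

(* arrows of Q_sigma, an arrow being the pair (source, target) *)
Definition arrow (x : V * V) : bool := int_arrow x.1 x.2 || ext_arrow x.1 x.2.

(* paths of Q_sigma: (starting vertex, arrows), composed left to right *)
Definition qpath := (V * seq (V * V))%type.
Definition tgt (p : qpath) : V := last p.1 [seq x.2 | x <- p.2].
Definition valid (p : qpath) : bool :=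
  [&& is_edge p.1, all arrow p.2 &
      [seq x.1 | x <- p.2] == belast p.1 [seq x.2 | x <- p.2]].
Definition mulp (p q : qpath) : qpath := (p.1, p.2 ++ q.2).

Definition tricycle (i j k : 'I_n) : seq (V * V) :=
  [:: (seg i j, seg i k); (seg i k, seg j k); (seg j k, seg i j)].
Definition tricycles : seq (seq (V * V)) :=
  flatten [seq flatten [seq [seq tricycle i j k
             | k : 'I_n <- enum 'I_n & (j < k)%N && is_tri i j k]
           | j : 'I_n <- enum 'I_n & (i < j)%N] | i <- enum 'I_n].

Definition nbr_edges (i : 'I_n) : seq V :=
  [seq seg i j | j <- sort (fun j k => (rot i j <= rot i k)%N)
                      [seq j <- enum 'I_n | (j != i) && is_edge (seg i j)]].
Definition bigcycle (i : 'I_n) : seq (V * V) :=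
  match nbr_edges i with
  | [::] => [::]
  | f0 :: fs => (last f0 fs, f0) :: zip (f0 :: fs) fs
  end.

Variable K : fieldType.

(* formal K-linear combinations of paths (elements of KQ_sigma) *)
Definition comb := seq (K * qpath).
Definition coef (c : comb) (p : qpath) : K := \sum_(x <- c | x.2 == p) x.1.
Definition mulc (c d : comb) : comb :=
  flatten [seq [seq (x.1 * y.1, mulp x.2 y.2) | y <- d & tgt x.2 == y.2.1]
          | x <- c].

Definition potential : seq (K * seq (V * V)) :=
  [seq (1, c) | c <- tricycles] ++
  [seq (-1, bigcycle i) | i : 'I_n <- enum 'I_n & has_diag i].

Definition dcyc (a : V * V) (c : seq (V * V)) : seq qpath :=
  [seq (a.2, drop i.+1 c ++ take i c) | i <- iota 0 (size c) & nth a c i == a].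
Definition dW (a : V * V) : comb :=
  flatten [seq [seq (w.1, p) | p <- dcyc a w.2] | w <- potential].

(* arrows whose source or target is not frozen *)
Definition eligible (a : V * V) : bool :=
  arrow a && (~~ is_side a.1 || ~~ is_side a.2).

(* c lies in the two-sided ideal J generated by the d_a W, a eligible *)
Definition inJ (c : comb) : Prop :=
  exists g : seq (K * qpath * (V * V) * qpath),
    all (fun t => [&& valid t.1.1.2, eligible t.1.2 & valid t.2]) g /\
    forall p, coef c p =
      coef (flatten [seq mulc (mulc [:: (t.1.1.1, t.1.1.2)] (dW t.1.2))
                              [:: (1, t.2)] | t <- g]) p.
End Polygon.

Section Tiled.
Variable K : fieldType.
Definition Kx := {fraction {poly K}}.
Definition xF : Kx := tofrac 'X.
Variable m : nat.
Variable a : 'I_m -> 'I_m -> int.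

Definition in_tiled (M : 'M[Kx]_m) : Prop :=
  forall i j, exists r : {poly K}, M i j = xF ^ (a i j) * tofrac r.

(* ((x^{a_ij} R)) is a tiled R-order: a_ij + a_jt >= a_it, and it is a
   (unital) R-subalgebra of M_m(K(x)) *)
Definition tiled_order : Prop :=
  (forall i j t, a i t <= a i j + a j t) /\ in_tiled 1%:M.
End Tiled.

Definition linext (K : fieldType) (n m : nat)
  (psi : qpath n -> 'M[Kx K]_m) (c : comb n K) : 'M[Kx K]_m :=
  \sum_(x <- c) (tofrac (x.1%:P) *: psi x.2).
Arguments tiled_order K {m} a.

(* Main.v *)
Require Import Defs.
From HB Require Import structures.
From mathcomp Require Import all_boot all_order all_algebra.
From mathcomp Require Import fraction zify.
Set Implicit Arguments. Unset Strict Implicit. Unset Printing Implicit Defensive.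
Import Order.TTheory GRing.Theory Num.Theory.

(* The vertices of the polygon are unrolled to nat, the integer t standing for
   P_(t mod n), so that an edge becomes a pair i < j < i + n, taken up to
   (i, j) ~ (j, i + n); every arrow then moves such a pair upwards.  The number
   of arrows along which the sum of the two vertex labels decreases is additive,
   is preserved by the relations, and is determined by the lifted end points of
   a walk.  Conversely, two walks with the same lifted end points are congruent:
   modulo the relations every walk is brought to a normal form which turns
   around one vertex, runs along the boundary and turns around a last vertex.
   Hence the walks from u to v modulo J are classified by their number of
   decreases, which takes exactly the values >= expo u v, and a walk acts as
   x to that number times a matrix unit. *)

(** Normal forms are not unique. When the target lift is far enough, a walk may start by turning
    around either end of its first edge, and the two routes are different words. They are compared
    through [cyc], a full turn around one end of an edge. The full turns around the two ends agree
    because both reduce to the three-cycle of an adjacent triangle, and a full turn can be moved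
    past turns and hops: it plays the role of the central element x. Each route is one full turn
    followed by the same walk to the preceding lift of the target.

    The lifts of an edge form a single chain (i, j), (j, i + n), (i + n, j + n), ..., and the sum of
    the quotients by n of both coordinates grows by one at each step. Hence a natural number, the
    count of decreases, is enough to name the lift reached.

    The ideal has generators only at corners carrying a diagonal. [hop] is chosen so that at any
    other corner the two sides of the relation are the same word, which keeps all corners on one
    footing. Lifts are often required to be positive because predecessors are taken in nat. *)

Section Segments.
Variable n : nat.
Implicit Types a b c d x y : 'I_n.

Lemma segC x y : seg x y = seg y x.
Proof.
rewrite /seg; case: (ltngtP x y) => // /val_inj -> //.
Qed.

Lemma seg_inj a b c d :
  seg a b = seg c d -> (a = c /\ b = d) \/ (a = d /\ b = c).
Proof. by rewrite /seg; do 2 case: ifP => _; case=> -> ->; auto. Qed.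

Lemma seg_lt a b : ((seg a b).1 < (seg a b).2) = (a != b).
Proof. by rewrite /seg -val_eqE; case: (ltngtP a b) => //= h; rewrite ?h ?ltnn; lia. Qed.

Lemma is_side_seg a b :
  is_side (seg a b) = (a != b) && ((a.+1 %% n == b) || (b.+1 %% n == a)).
Proof. by rewrite /is_side seg_lt /seg; case: ifP => //= _; rewrite orbC. Qed.

End Segments.

(** * Lifted edges and crossings *)

Section Lifts.
Variables (n : nat) (s : {set 'I_n * 'I_n}).
Hypothesis n_ge3 : 2 < n.
Hypothesis sP : triangulation s.

Let n_gt0 : 0 < n. Proof. exact: leq_trans n_ge3. Qed.

Definition pvertex (t : nat) : 'I_n := insubd (Ordinal n_gt0) (t %% n).

Local Notation vx := pvertex.

Lemma val_vx t : vx t = t %% n :> nat.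
Proof. by rewrite val_insubd ltn_pmod. Qed.

Definition pedge (i j : nat) := seg (vx i) (vx j).
Local Notation ed := pedge.
Definition is_pedge (i j : nat) := is_edge s (ed i j).
Local Notation E := is_pedge.

Lemma val_vx_small t : t < n -> vx t = t :> nat.
Proof. by rewrite val_vx; apply: modn_small. Qed.

Lemma vx_val (v : 'I_n) : vx v = v.
Proof. by apply: val_inj; rewrite /= val_vx modn_small. Qed.

Lemma vxDn t : vx (t + n) = vx t.
Proof. by apply: val_inj; rewrite /= !val_vx modnDr. Qed.

Lemma vxDMn t q : vx (t + q * n) = vx t.
Proof. by apply: val_inj; rewrite /= !val_vx addnC modnMDl. Qed.

Lemma val_vx2 t : t < n + n -> vx t = (if t < n then t else t - n) :> nat.
Proof.
move=> t2; case: ltnP => h; first exact: val_vx_small.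
by rewrite -{1}(subnK h) vxDn val_vx_small //; lia.
Qed.

Lemma vx_eq i j : i <= j < i + n -> (vx i == vx j) = (i == j).
Proof.
move=> h; rewrite -val_eqE /= !val_vx; apply/eqP/eqP => [|->//] eqij.
have : i == j %[mod n] by apply/eqP.
rewrite eq_sym eqn_mod_dvd; last lia.
case: (posnP (j - i)) => [|p /(dvdn_leq p)]; lia.
Qed.

Lemma edC i j : ed i j = ed j i. Proof. exact: segC. Qed.
Lemma edDr i j : ed i (j + n) = ed i j. Proof. by rewrite /pedge vxDn. Qed.
Lemma edDl i j : ed (i + n) j = ed i j. Proof. by rewrite /pedge vxDn. Qed.
Lemma EC i j : E i j = E j i. Proof. by rewrite /is_pedge edC. Qed.
Lemma EDr i j : E i (j + n) = E i j. Proof. by rewrite /is_pedge edDr. Qed.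
Lemma EDl i j : E (i + n) j = E i j. Proof. by rewrite /is_pedge edDl. Qed.

Lemma succ_vx i : (vx i).+1 %% n = vx i.+1.
Proof. by rewrite !val_vx -addn1 modnDml addn1. Qed.

Lemma side_ed i j : i < j < i + n -> is_side (ed i j) = (j == i.+1) || (j.+1 == i + n).
Proof.
move=> h; rewrite is_side_seg !succ_vx !val_eqE -(vxDn i).
rewrite (vx_eq (i := j.+1)) ?vxDn; last lia.
rewrite (vx_eq (i := i.+1)) ?(vx_eq (i := i)); try lia.
Qed.

Lemma edDMn i j q : ed (i + q * n) (j + q * n) = ed i j.
Proof. by rewrite /pedge !vxDMn. Qed.

Lemma EDMn i j q : E (i + q * n) (j + q * n) = E i j.
Proof. by rewrite /is_pedge edDMn. Qed.

(** Translation by multiples of [n] brings the smallest index below [n], where the ordered pair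
    stored by [seg] can be computed. *)
Lemma lift_redP a (Q : nat -> Prop) :
  (forall a0 q, a0 < n -> Q (a0 + q * n)) -> Q a.
Proof. by move=> h; rewrite (divn_eq a n) addnC; apply: h; rewrite ltn_pmod. Qed.

Lemma shift_le a q b : a + q <= b -> exists2 b0, b = b0 + q & a <= b0.
Proof. by move=> h; exists (b - q); lia. Qed.

Lemma ed1 i j : i < n -> i < j -> j < i + n ->
  (ed i j).1 = (if j < n then i else j - n) :> nat.
Proof.
move=> li ij ji; rewrite /pedge /seg !val_vx2 ?li; try lia.
case: (ltnP j n) => jn; first by rewrite ij /= val_vx2 ?li; lia.
by rewrite ifF /= ?val_vx2 ?ifF; lia.
Qed.

Lemma ed2 i j : i < n -> i < j -> j < i + n ->
  (ed i j).2 = (if j < n then j else i) :> nat.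
Proof.
move=> li ij ji; rewrite /pedge /seg !val_vx2 ?li; try lia.
case: (ltnP j n) => jn; first by rewrite ij /= val_vx2 ?jn; lia.
by rewrite ifF /= ?val_vx2 ?li; lia.
Qed.

Lemma cross_ed a b c d :
  a < b -> b < c -> c < d -> d < a + n -> cross (ed a c) (ed b d).
Proof.
elim/lift_redP: a => a q an ab bc cd da.
have [|b0 eb _] := @shift_le a (q * n) b; first by lia.
have [|c0 ec _] := @shift_le a (q * n) c; first by lia.
have [|d0 edd _] := @shift_le a (q * n) d; first by lia.
subst b c d; rewrite !edDMn.
have {ab} ab : a < b0 by lia.
have {bc} bc : b0 < c0 by lia.
have {cd} cd : c0 < d0 by lia.
have {da} da : d0 < a + n by lia.
case: (ltnP b0 n) => bn.
  rewrite /cross !ed1 ?ed2; try lia.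
  by case: ifP => cn; case: ifP => dn; lia.
have -> : ed b0 d0 = ed (b0 - n) (d0 - n) by rewrite -[RHS]edDl -[RHS]edDr !subnK //; lia.
rewrite /cross ?ed1 ?ed2; try lia.
by case: (ltnP c0 n) => cn; case: (ltnP (d0 - n) n) => dn; lia.
Qed.

Lemma noncross a b c d :
  a < b -> b < c -> c < d -> d < a + n -> E a c -> E b d -> False.
Proof.
have [_ nc _] := sP.
move=> ab bc cd da; rewrite /is_pedge /is_edge !side_ed; try lia.
have := cross_ed ab bc cd da.
case: (boolP (ed a c \in s)) => [sac|]; last lia.
case: (boolP (ed b d \in s)) => [sbd|]; last lia.
by rewrite (negbTE (nc _ _ sac sbd)).
Qed.

(** Here the maximality of [s] enters. A crossing diagonal has one end on each of the two arcs cut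
    out by [a] and [c], so its ends can be lifted in this order. *)
Lemma exists_crossing a c :
  a < c -> c < a + n -> ~~ E a c ->
  exists b d, [/\ a < b, b < c, c < d, d < a + n & E b d].
Proof.
have [sd _ mx] := sP.
elim/lift_redP: a => a q an ac ca.
have [|c0 ec _] := @shift_le a (q * n) c; first by lia.
subst c; have {ac} ac : a < c0 by lia.
have {ca} ca : c0 < a + n by lia.
rewrite EDMn => nE.
suff [b [d [? ? ? ? ?]]] : exists b d, [/\ a < b, b < c0, c0 < d, d < a + n & E b d].
  by exists (b + q * n), (d + q * n); rewrite EDMn; split=> //; lia.
rewrite /is_pedge /is_edge negb_or in nE; case/andP: nE => ns nin.
have dg : is_diag (ed a c0).
  by move: ns; rewrite /is_diag /is_side /pedge seg_lt vx_eq ?neq_ltn ?ac //; lia.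
have [[x y] xs] := mx _ dg nin.
have xy : x < y by have /andP[] := sd _ xs.
have Exy b d : vx b = x -> vx d = y -> E b d.
  by move=> bx dy; rewrite /is_pedge /is_edge /pedge bx dy /seg xy xs orbT.
have lx := ltn_ord x; have ly := ltn_ord y.
rewrite /cross /pedge /seg !val_vx2 ?an; try lia.
case: (ltnP c0 n) => cn; rewrite ?ac /= ?ifF ?val_vx2 ?an ?cn /=; try lia.
- case/orP=> /andP[/andP[h1 h2] h3].
    by exists x, y; split; try lia; apply: Exy; rewrite vx_val.
  by exists y, (x + n); split; try lia; rewrite EC; apply: Exy; rewrite ?vxDn vx_val.
- rewrite ifF; last lia.
  case/orP=> /andP[/andP[h1 h2] h3].
    by exists y, (x + n); split; try lia; rewrite EC; apply: Exy; rewrite ?vxDn vx_val.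
  by exists (x + n), (y + n); split; try lia; apply: Exy; rewrite ?vxDn vx_val.
Qed.

End Lifts.

(** * Triangles and arrows in lifted coordinates *)

Section Arrows.
Variables (n : nat) (s : {set 'I_n * 'I_n}).
Hypothesis n_ge3 : 2 < n.
Hypothesis sP : triangulation s.
Local Notation vx := (pvertex n_ge3).
Local Notation ed := (pedge n_ge3).
Local Notation E := (is_pedge s n_ge3).

Lemma E_neq i j : E i j -> vx i != vx j.
Proof.
rewrite /is_pedge /is_edge is_side_seg => /orP[/andP[]|] //.
by have [sd _ _] := sP; move=> /sd /andP[]; rewrite seg_lt.
Qed.

Lemma E_side i : E i i.+1.
Proof. by rewrite /is_pedge /is_edge side_ed ?eqxx //; lia. Qed.

Lemma E_side' i : E i (i + n).-1.
Proof. by rewrite /is_pedge /is_edge side_ed ?eqxx //; lia. Qed.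

(** Otherwise an edge crosses [(j, k)], with an end [b] strictly between. Its other end is the
    vertex [i], against the absence of edges in between, or the edge crosses [(i, k)] or
    [(i, j)]. *)
Lemma E_consec i j k :
  i < j -> j < k -> k < i + n -> E i j -> E i k ->
  (forall t, j < t -> t < k -> ~~ E i t) -> E j k.
Proof.
move=> ij jk ki Eij Eik nE; case: (boolP (E j k)) => // nEjk.
have [|b [d [jb bk kd dj Ebd]]] := exists_crossing sP jk _ nEjk; first lia.
exfalso; case: (ltngtP d (i + n)) => di.
- by apply: (@noncross _ _ n_ge3 sP i b k d) => //; lia.
- apply: (@noncross _ _ n_ge3 sP i (d - n) j b) => //; try lia.
  by rewrite EC -EDr subnK //; lia.
- by move: (nE b jb bk); rewrite EC -EDr -di Ebd.
Qed.

Lemma exists_triangle i k :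
  i.+1 < k -> k < i + n -> E i k -> exists m, [/\ i < m, m < k, E i m & E m k].
Proof.
move=> ik ki Eik.
(* The third corner is the last neighbour of [i] before [k]; [i.+1] is always a candidate. *)
have ex : exists m, [&& i < m, m < k & E i m] by exists i.+1; rewrite E_side ltnSn ik.
have ub m : [&& i < m, m < k & E i m] -> m <= k by case/and3P; lia.
case: (ex_maxnP ex ub) => m /and3P[im mk Eim] mx.
exists m; split=> //; apply: (E_consec im mk ki Eim Eik) => t mt tk.
by apply/negP => Eit; have := mx t; rewrite Eit tk (ltn_trans im mt); lia.
Qed.

Lemma exists_lift i (v : 'I_n) : exists2 t, i <= t < i + n & v = vx t.
Proof.
have n0 : 0 < n by lia.
have hv := ltn_ord v.
have iq := divn_eq i n; have ir : i %% n < n by rewrite ltn_pmod.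
case: (leqP (i %% n) v) => h.
  by exists (v + i %/ n * n); [lia | rewrite vxDMn vx_val].
by exists (v + n + i %/ n * n); [lia | rewrite vxDMn vxDn vx_val].
Qed.

Lemma rot_vx i j : i <= j < i + n -> Defs.rot (vx i) (vx j) = j - i.
Proof.
move=> h; rewrite /Defs.rot !val_vx.
have n0 : 0 < n by lia.
have iq := divn_eq i n; have ir : i %% n < n by rewrite ltn_pmod.
rewrite -addnBA; last by apply: ltnW.
rewrite modnDml.
have -> : j + (n - i %% n) = i %/ n * n + (j - i + n) by lia.
rewrite modnMDl.
by rewrite modnDr modn_small; lia.
Qed.

Lemma is_tri_ed i j k : is_tri s (vx i) (vx j) (vx k) = [&& E i j, E j k & E i k].
Proof.
rewrite /is_tri /is_pedge /pedge; apply/and5P/and3P => [[_ _ _ -> /andP[-> ->]]//|[h1 h2 h3]].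
by split; rewrite ?E_neq //; apply/andP.
Qed.

Lemma arrow_int i j k : i < j -> j < k -> k < i + n ->
  E i j -> E j k -> E i k -> arrow s (ed i j, ed i k).
Proof.
move=> ij jk ki h1 h2 h3; apply/orP; left; apply/existsP; exists (vx i).
apply/existsP; exists (vx j); apply/existsP; exists (vx k).
by rewrite is_tri_ed h1 h2 h3 !eqxx !rot_vx //; lia.
Qed.

Lemma arrow_ext t : has_diag s (vx t.+1) -> arrow s (ed t t.+1, ed t.+1 t.+2).
Proof.
move=> h; apply/orP; right; apply/existsP; exists (vx t.+1).
apply/existsP; exists (vx t); apply/existsP; exists (vx t.+2).
by rewrite h !succ_vx !eqxx.
Qed.

(** An internal arrow turns around one end of its source: around [i] it raises [j], around [j] it
    raises [i + n] in the equivalent lift [(j, i + n)]. An external arrow leaves a side, which is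
    [(t, t.+1)] in one of these two lifts. *)
Lemma arrow_inv i j b : i < j < i + n -> arrow s (ed i j, b) ->
  [\/ exists k, [/\ j < k, k < i + n, E j k, E i k & b = ed i k],
      exists k, [/\ i + n < k, k < j + n, E i k, E j k & b = ed j k] |
      exists t, [/\ ((i, j) == (t, t.+1)) || ((j, i + n) == (t, t.+1)),
                    has_diag s (vx t.+1) & b = ed t.+1 t.+2]].
Proof.
move=> ij /orP[/existsP[x /existsP[y /existsP[z]]]|/existsP[x /existsP[y /existsP[z]]]].
  case/and4P=> tr /eqP /= eij /eqP /= eb lt.
  have [[ex ey]|[ey ex]] := seg_inj (esym eij); subst x y.
    constructor 1; have [k hk ez] := exists_lift i z; subst z; exists k.
    by move: tr lt; rewrite is_tri_ed !rot_vx ?hk // => [/and3P[]|]; [split=> //; lia|lia].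
  constructor 2; have [k hk ez] := exists_lift j z; subst z; exists k.
  rewrite -(vxDn n_ge3 i) !rot_vx in lt; try lia.
  by move: tr; rewrite is_tri_ed => /and3P[]; split=> //; lia.
case/and5P=> hx /eqP xy /eqP zx /= /eqP eij /eqP eb.
constructor 3.
have step (w u : 'I_n) t : w = vx t -> w.+1 %% n = u :> nat -> u = vx t.+1.
  by move=> -> h; apply: val_inj; rewrite /= -succ_vx h.
have [[ey ex]|[ex ey]] := seg_inj (esym eij); subst x y.
  have e1 := step _ _ _ (erefl _) xy; have e2 := step _ _ _ e1 zx; subst z.
  move/eqP: e1; rewrite eq_sym vx_eq => [/eqP e1|]; last by lia.
  by subst j; exists i; rewrite eqxx; split.
have e1 := step _ _ _ (erefl _) xy; have e2 := step _ _ _ e1 zx; subst z.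
exists j; split; [|by rewrite -e1|by rewrite eb /pedge -e1].
move/eqP: e1; rewrite -(vxDn n_ge3 i) eq_sym vx_eq; last by lia.
by move=> /eqP <-; rewrite eqxx orbT.
Qed.
End Arrows.

(** * Turns, hops and the congruence of walks *)

Section Walks.
Variables (n : nat) (s : {set 'I_n * 'I_n}).
Hypothesis n_ge3 : 2 < n.
Hypothesis sP : triangulation s.
Local Notation vx := (pvertex n_ge3).
Local Notation ed := (pedge n_ge3).
Local Notation E := (is_pedge s n_ge3).
Local Notation node := ('I_n * 'I_n)%type.

(** The turn around [i] from [j] to [k]. The start is excluded and the end included, so that turns
    concatenate and match the encoding of a walk by the nodes after its start. *)
Definition fan i j k : seq node := [seq ed i t | t <- iota j.+1 (k - j) & E i t].

Lemma fan_nil i j : fan i j j = [::].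
Proof. by rewrite /fan subnn. Qed.

Lemma fan_cat i j m k : j <= m <= k -> fan i j m ++ fan i m k = fan i j k.
Proof.
move=> h; rewrite /fan -map_cat -filter_cat.
have -> : k - j = (m - j) + (k - m) by lia.
by rewrite iotaD; have -> : j.+1 + (m - j) = m.+1 by lia.
Qed.

Lemma fan1 i k : fan i k k.+1 = if E i k.+1 then [:: ed i k.+1] else [::].
Proof. by rewrite /fan subSnn /=; case: ifP. Qed.

Lemma fanDl i j k : fan (i + n) j k = fan i j k.
Proof.
by rewrite /fan (eq_filter (a2 := E i)) ?(eq_map (g := ed i)) // => t; rewrite ?edDl ?EDl.
Qed.

Lemma fanDr i j k : fan i (j + n) (k + n) = fan i j k.
Proof.
rewrite /fan subnDr -addSn (addnC j.+1) iotaDl filter_map -map_comp.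
rewrite (eq_filter (a2 := E i)); last by move=> t /=; rewrite addnC EDr.
by apply: eq_map => t /=; rewrite addnC edDr.
Qed.

Lemma fan_last i j k : j <= k -> E i k -> last (ed i j) (fan i j k) = ed i k.
Proof.
case: k => [|k]; first by case: j.
rewrite leq_eqVlt => /orP[/eqP ->|jk] Eik; first by rewrite fan_nil.
by rewrite -(fan_cat _ (m := k)) ?fan1 ?Eik ?last_cat //; lia.
Qed.

(** An intermediate edge at [i] would cross [(j, k)]: turning across a triangle takes a single
    arrow. *)
Lemma fan_consec i j k : i < j -> j < k -> k < i + n -> E j k -> E i k ->
  fan i j k = [:: ed i k].
Proof.
move=> ij; case: k => [|k] // jk ki Ejk Eik.
rewrite -(fan_cat _ (m := k)) ?fan1 ?Eik; last lia.
rewrite /fan (eq_in_filter (a2 := pred0)) ?filter_pred0 // => t.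
rewrite mem_iota => ht; apply/negP => Eit.
by apply: (@noncross _ _ n_ge3 sP i j t k.+1) => //; lia.
Qed.

Lemma fan_consec_lt i j k : j < k -> k < i -> i < j + n -> E j k -> E i k ->
  fan i j k = [:: ed i k].
Proof.
move=> jk ki ij Ejk Eik; rewrite -fanDr fan_consec ?edDr ?EDr ?EDl //; lia.
Qed.

(* From [m - 1, m] to [m, m + 1]: the external arrow at [m] or, when [m] carries
   no diagonal, the two internal arrows of the triangle cutting [m] off. *)
Definition hop m : seq node :=
  if has_diag s (vx m) then [:: ed m m.+1] else [:: ed (m + n).-1 m.+1; ed m m.+1].

Lemma hop_last u m : last u (hop m) = ed m m.+1.
Proof. by rewrite /hop; case: ifP. Qed.

Lemma edSDn i j : ed i (j + n).+1 = ed i j.+1.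
Proof. by rewrite -addSn edDr. Qed.

Lemma hopDn m : hop (m + n) = hop m.
Proof.
rewrite /hop vxDn edDl !edSDn.
have -> : (m + n + n).-1 = (m + n).-1 + n by lia.

by rewrite edDl.
Qed.

Definition hops m r : seq node := flatten [seq hop t | t <- iota m r].

Lemma hops0 m : hops m 0 = [::]. Proof. by []. Qed.
Lemma hops1 m : hops m 1 = hop m. Proof. by rewrite /hops /= cats0. Qed.

Lemma hops_cat m r1 r2 : hops m r1 ++ hops (m + r1) r2 = hops m (r1 + r2).
Proof. by rewrite /hops iotaD map_cat flatten_cat. Qed.

Lemma hopsS m r : hop m ++ hops m.+1 r = hops m r.+1.
Proof. by rewrite -hops1 -[r.+1]add1n -hops_cat addn1. Qed.

Lemma hopsDn m r : hops (m + n) r = hops m r.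
Proof. by elim: r m => // r IH m; rewrite -!hopsS hopDn -addSn IH. Qed.

Lemma ed_pred m : 0 < m -> ed (m + n).-1 m = ed m.-1 m.
Proof. by case: m => // m _; rewrite /= edDl. Qed.

Lemma E_pred m : 0 < m -> E m m.-1.
Proof. by case: m => // m _; rewrite EC E_side. Qed.

Lemma hops_last m r : 0 < m -> last (ed m.-1 m) (hops m r) = ed (m + r).-1 (m + r).
Proof.
by elim: r m => [|r IH] m m0; rewrite ?addn0 // -hopsS last_cat hop_last (IH m.+1) // addSnnS.
Qed.

(* Walks are given by the nodes following the start [u].  The last constructor
   is the relation [d_a W] for [a] the arrow from [m, k] to [j, m] at the corner
   [m] of the triangle [j < m < k]. *)
Inductive eqv : node -> seq node -> seq node -> Prop :=
| eqv_refl u p : eqv u p p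
| eqv_sym u p q : eqv u p q -> eqv u q p
| eqv_trans u p q r : eqv u p q -> eqv u q r -> eqv u p r
| eqv_cons u v p q : eqv v p q -> eqv u (v :: p) (v :: q)
| eqv_post u p q r : eqv u p q -> eqv u (p ++ r) (q ++ r)
| eqv_tri j m k : j < m -> m < k -> k < j + n -> E j m -> E m k -> E j k ->
    eqv (ed j m) [:: ed j k; ed m k] (fan m j m.-1 ++ hop m ++ fan m m.+1 k).

Lemma eqv_pre u p q r : eqv (last u r) p q -> eqv u (r ++ p) (r ++ q).
Proof. by elim: r u => [|v r IH] u //= /IH; apply: eqv_cons. Qed.

Lemma eqv_cat u v p q p' q' : last u p = v -> eqv u p q -> eqv v p' q' ->
  eqv u (p ++ p') (q ++ q').
Proof.
move=> <- h1 h2; apply: (eqv_trans (q := p ++ q')); first exact: eqv_pre.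
exact: eqv_post.
Qed.

(* From [i, j] to [k, l] when [j <= k]. *)
Definition thru i j k l := fan j i j.-1 ++ hops j (k.+1 - j) ++ fan k k.+1 l.

(* The induction cuts off the triangle on the inner side of [a, c]. *)
Lemma fan_turn a b c d :
  a < b -> b <= c -> c < a + n -> a <= d -> d < c -> b <= d.+1 ->
  E a b -> E a c -> E d c ->
  eqv (ed a b) (fan a b c ++ fan c a d) (thru a b d c).
Proof.
have [N] := ubnP (c - a); elim: N a b c d => // N IH a b c d cN ab bc ca ad dc bd Eab Eac Edc.
case: (leqP b d) => [{}bd|db]; last first.
  (* No vertex is left to hop over. Unless [a = d] or [c = d.+1], the edges [(a, d.+1)] and [(d, c)]
     would cross. *)
  have eb : b = d.+1 by lia.
  subst b; rewrite /thru subnn hops0 /=.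
  have [ea|ea] := eqVneq a d; first by subst d; rewrite !fan_nil cats0; apply: eqv_refl.
  have [ec|ec] := eqVneq c d.+1; first by subst c; rewrite !fan_nil cats0; apply: eqv_refl.
  by exfalso; apply: (@noncross _ _ n_ge3 sP a d d.+1 c) => //; lia.
have [|m [am mc Eam Emc]] := exists_triangle sP _ ca Eac; first lia.
have bm : b <= m.
  rewrite leqNgt; apply/negP => mb.
  by apply: (@noncross _ _ n_ge3 sP a m b c) => //; lia.
have md : m <= d.
  rewrite leqNgt; apply/negP => dm.
  by apply: (@noncross _ _ n_ge3 sP a d m c) => //; lia.
(* With [a, m, c] a triangle, the middle of the walk reads [(a, m)], [(a, c)], [(m, c)]. The
   relation at the corner [m] replaces it by a route around [m], leaving one instance below [(a, m)]
   and one below [(m, c)]. *)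
rewrite -(fan_cat a (j := b) (m := m)) ?bm ?(ltnW mc) // (fan_consec (j := m)) //.
rewrite -(fan_cat c (j := a) (m := m)) ?md ?(ltnW am) //.
rewrite (fan_consec_lt (j := a)) //; last by rewrite EC.
have IH1 := IH a b m m.-1 _ ab bm _ _ _ _ Eab Eam _.
have {IH1} IH1 : eqv (ed a b) (fan a b m ++ fan m a m.-1) (thru a b m.-1 m).
  by apply: IH1; rewrite 1?EC ?E_pred //; lia.
have {IH} IH2 : eqv (ed m m.+1) (fan m m.+1 c ++ fan c m d) (thru m m.+1 d c).
  by apply: IH; rewrite ?E_side //; lia.
apply: (eqv_trans (q := (fan a b m ++ fan m a m.-1) ++ hop m ++ fan m m.+1 c ++ fan c m d)).
  rewrite -!catA; apply: eqv_pre; rewrite (fan_last bm Eam).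
  rewrite (edC _ c m); have := eqv_tri am mc ca Eam Emc Eac.
  by move/(eqv_post (fan c m d)); rewrite -!catA.
have -> : thru a b d c = thru a b m.-1 m ++ hop m ++ thru m m.+1 d c.
  rewrite /thru prednK; last lia.
  rewrite !fan_nil cats0 /= -!catA; congr (_ ++ _).
  rewrite (catA (hop m)) hopsS catA; congr (_ ++ _).
  have -> : d.+1 - b = m - b + (d.+1 - m.+1).+1 by lia.
  by rewrite -hops_cat subnKC.
apply: eqv_cat (erefl _) IH1 _.
by apply: eqv_pre; rewrite hop_last.
Qed.

End Walks.

(** * Full turns and normal forms *)

Section NormalForms.
Variables (n : nat) (s : {set 'I_n * 'I_n}).
Hypothesis n_ge3 : 2 < n.
Hypothesis sP : triangulation s.
Local Notation ed := (pedge n_ge3).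
Local Notation E := (is_pedge s n_ge3).
Local Notation node := ('I_n * 'I_n)%type.
Local Notation fan := (fan s n_ge3).
Local Notation hop := (hop s n_ge3).
Local Notation hops := (hops s n_ge3).
Local Notation thru := (thru s n_ge3).
Local Notation eqv := (eqv s n_ge3).

Lemma fan_pred i j m : 0 < m -> fan i (j + n) (m + n).-1 = fan i j m.-1.
Proof. by case: m => // m _; rewrite /= fanDr. Qed.

Lemma thruDn i j k l : 0 < j -> thru (i + n) (j + n) (k + n) (l + n) = thru i j k l.
Proof.
move=> j0; rewrite /thru fan_pred // fanDl hopsDn -addSn fanDr fanDl.
by congr (_ ++ hops _ _ ++ _); lia.
Qed.

(** One full turn around the vertex [i], based at the edge [(i, j)]. It leads to the next lift
    [(j, i + n)] of the same edge, so it stands for x. *)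
Definition cyc i j := fan i j (i + n).-1 ++ hop i ++ fan i i.+1 j.

Lemma cycDn i j : 0 < i -> cyc (i + n) (j + n) = cyc i j.
Proof.
move=> i0; rewrite /cyc !fanDl hopDn -addSn fanDr.
have -> : (i + n + n).-1 = (i + n).-1 + n by lia.
by rewrite fanDr.
Qed.

(** Both full turns reduce to the three-cycle of the triangle, one by the relation at the corner
    [i], the other by the relation at the corner [j]. *)
Lemma cyc_tri i m j : i < m -> m < j -> j < i + n -> E i m -> E m j -> E i j ->
  eqv (ed i j) (cyc i j) (cyc j (i + n)).
Proof.
move=> im mj ji Eim Emj Eij.
have [Emi Ejm Eji] : [/\ E m i, E j m & E j i] by split; rewrite EC.
apply: (eqv_trans (q := [:: ed j m; ed i m; ed i j])).
  have T := @eqv_tri _ s n_ge3 j (i + n) (m + n) ji.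
  rewrite ltn_add2r !EDr EDl in T.
  have {}T := T im (_ : m + n < j + n) Eji Eim Ejm; rewrite ltn_add2r in T.
  rewrite -addSn !fanDl hopDn fanDr !edDr edDl (edC _ j i) in T.
  move: (eqv_sym (eqv_post [:: ed i j] (T mj))).
  rewrite /= /cyc.
  rewrite -(fan_cat _ _ i (j := i.+1) (m := m) (k := j)) ?im ?(ltnW mj) //.
  by rewrite (fan_consec sP (j := m)) // -!catA.
have T := @eqv_tri _ s n_ge3 m j (i + n) mj ji.
rewrite !EDr !edDr in T; have {T} := T _ Emj Eji Emi.
rewrite /cyc fan_pred; last by lia.
rewrite -(fan_cat _ _ j (j := i) (m := m) (k := j.-1)); last by lia.
rewrite (fan_consec_lt sP (j := i)) //.
rewrite (edC _ m i) (edC _ j i) (edC _ m j) => T.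
by apply/eqv_cons/T; lia.
Qed.

(** An edge has a triangle on at least one side. For [j = i.+1] it is found from the equivalent lift
    [(j, i + n)], which merely exchanges the two full turns. *)
Lemma cyc_swap i j : 0 < i -> i < j -> j < i + n -> E i j ->
  eqv (ed i j) (cyc i j) (cyc j (i + n)).
Proof.
move=> i0 ij ji Eij; have [lt|] := ltnP i.+1 j.
  have [m [im mj Eim Emj]] := exists_triangle sP lt ji Eij.
  exact: cyc_tri Eim Emj Eij.
move=> le; have ej : j = i.+1 by lia.
have Eji : E j (i + n) by rewrite EDr EC.
have [||m [jm mi Ejm Emi]] := exists_triangle sP _ _ Eji; try by lia.
have := cyc_tri jm mi _ Ejm Emi Eji.
rewrite edDr (edC _ j i) cycDn // => T; apply/eqv_sym/T; lia.
Qed.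

Lemma cyc_fan i j l : i < j -> j <= l -> l < i + n ->
  cyc i j ++ fan i j l = fan i j l ++ cyc i l.
Proof.
move=> ij jl li; rewrite /cyc -!catA fan_cat; last by lia.
by rewrite (catA (fan i j l)) fan_cat //; lia.
Qed.

(** Normal forms from the lift [(i, j)] to the lift [(k, l)]. The second constructor is the first
    one read in the lifts [(j, i + n)] and [(l, k + n)]; for a distant target both apply and give
    different words. *)
Inductive rep : nat -> nat -> nat -> nat -> seq node -> Prop :=
| rep_thru i j k l : j <= k -> rep i j k l (thru i j k l)
| rep_thru_swap i j k l : i + n <= l -> rep i j k l (thru j (i + n) l (k + n))
| rep_fanl i j l : j <= l -> l < i + n -> rep i j i l (fan i j l)
| rep_fanr i j k : i <= k -> k < j -> rep i j k j (fan j i k).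

Lemma rep_swap i j k l p : 0 < j -> rep i j k l p -> rep j (i + n) l (k + n) p.
Proof.
move=> j0 r; case: r j0 => {i j k l p} [i j k l jk|i j k l il|i j l jl li|i j k ik kj] j0.
- by rewrite -thruDn //; apply: rep_thru_swap; lia.
- exact: rep_thru.
- by rewrite -(fanDl _ _ i); apply: rep_fanr.
- by rewrite -fanDr; apply: rep_fanl; lia.
Qed.

Lemma rep_unshift i j k l p : 0 < i -> 0 < j ->
  rep (i + n) (j + n) (k + n) (l + n) p -> rep i j k l p.
Proof.
move=> i0 j0; move: (erefl (i + n)) (erefl (j + n)) (erefl (k + n)) (erefl (l + n)).
move: {-1}(i + n) {-1}(j + n) {-1}(k + n) {-1}(l + n) => i' j' k' l' ei ej ek el r.
case: r ei ej ek el => {i' j' k' l' p}.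
- move=> i' j' k' l' jk ei ej ek el; subst.
  by rewrite thruDn //; apply: rep_thru; lia.
- move=> i' j' k' l' jk ei ej ek el; subst; rewrite thruDn; last lia.
  by apply: rep_thru_swap; lia.
- move=> i' j' l' jl li ei ej; rewrite -ei => /addIn -> el; subst; rewrite fanDl fanDr.
  by apply: rep_fanl; lia.
- move=> i' j' k' ik kj ei ej ek; rewrite -ej => /addIn ->; subst; rewrite fanDl fanDr.
  by apply: rep_fanr; lia.
Qed.

Lemma rep_unswap i j k l p : 0 < i -> 0 < j ->
  rep j (i + n) l (k + n) p -> rep i j k l p.
Proof. by move=> i0 j0 /rep_swap r; apply: rep_unshift => //; apply: r; lia. Qed.

Lemma rep_exists i j k l : i < j -> j < i + n -> k < l -> l < k + n ->
  E i j -> E k l -> i <= k -> j <= l -> exists p, rep i j k l p.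
Proof.
move=> ij ji kl lk Eij Ekl ik jl.
have [jk|kj] := leqP j k; first by eexists; apply: rep_thru.
have [il|li] := leqP (i + n) l; first by eexists; apply: rep_thru_swap.
have [<-|ki] := eqVneq i k; first by eexists; apply: rep_fanl.
have [<-|lj] := eqVneq j l; first by eexists; apply: rep_fanr.
by exfalso; apply: (@noncross _ _ n_ge3 sP i k j l) => //; lia.
Qed.

(** If [p] goes on turning around [i], the two turns concatenate. If [p] starts with a turn around
    [j'], [fan_turn] trades the bend at [(i, j')] for a route along the boundary. *)
Lemma fan_rep i j j' k l p : i < j -> j <= j' -> j' < i + n -> k < l ->
  E i j -> E i j' -> E k l -> rep i j' k l p ->
  exists2 q, rep i j k l q & eqv (ed i j) (fan i j j' ++ p) q.
Proof.
move=> + + + + Eij + + r.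
case: r Eij => {i j' k l p}.
- move=> i j' k l jk Eij ij jj ji kl Eij' Ekl.
  exists (thru i j k l); first by apply: rep_thru; lia.
  have Ep : E j'.-1 j' by rewrite EC E_pred //; lia.
  have T : eqv (ed i j) (fan i j j' ++ fan j' i j'.-1) (thru i j j'.-1 j').
    by apply: fan_turn => //; lia.
  rewrite /thru catA; apply: eqv_trans (eqv_post _ T) _.
  rewrite /thru prednK ?fan_nil ?cats0; last lia.
  have -> : k.+1 - j = (j' - j) + (k.+1 - j') by lia.
  by rewrite -hops_cat subnKC // -!catA; apply: eqv_refl.
- move=> i j' k l il Eij ij jj ji kl Eij' Ekl.
  exists (thru j (i + n) l (k + n)); first exact: rep_thru_swap.
  rewrite /thru !fanDl catA fan_cat; last lia.
  exact: eqv_refl.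
- move=> i j' l jl li Eij ij jj ji il Eij' Eil.
  exists (fan i j l); first by apply: rep_fanl; lia.
  by rewrite fan_cat; [apply: eqv_refl|lia].
- move=> i j' k ik kj Eij ij jj ji _ Eij' Ekj.
  have [jk|kj'] := leqP j k.
    by exists (thru i j k j'); [apply: rep_thru|apply: fan_turn => //; lia].
  have [ki|ki] := eqVneq k i.
    subst k; rewrite fan_nil cats0; exists (fan i j j'); last exact: eqv_refl.
    exact: rep_fanl.
  have [ej|ej] := eqVneq j j'.
    subst j'; rewrite fan_nil; exists (fan j i k); last exact: eqv_refl.
    exact: rep_fanr.
  by exfalso; apply: (@noncross _ _ n_ge3 sP i k j j') => //; lia.
Qed.

Lemma hop_rep i k l p : 0 < i -> k < l -> l < k + n -> rep i.+1 i.+2 k l p ->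
  exists2 q, rep i i.+1 k l q & eqv (ed i i.+1) (hop i.+1 ++ p) q.
Proof.
move: {-2}i.+1 {-2}i.+2 (erefl i.+1) (erefl i.+2) => i' j' ei ej i0 kl lk r.
case: r ei ej kl lk => {i' j' k l p}.
- move=> i' j' k l jk ei ej kl lk; subst.
  exists (thru i i.+1 k l); first by apply: rep_thru; lia.
  rewrite /thru !fan_nil !cat0s catA hopsS.
  have -> : (k.+1 - i.+2).+1 = k.+1 - i.+1 by lia.
  exact: eqv_refl.
- move=> i' j' k l jk ei ej kl lk; subst.
  exists (thru i.+1 (i + n) l (k + n)); first by apply: rep_thru_swap; lia.
  (* For a side, the equality of full turns says that the turn around [i] followed by the hop at [i]
     equals the hop at [i.+1] followed by the turn around [i.+1]. *)
  have T : eqv (ed i i.+1) (cyc i i.+1) (cyc i.+1 (i + n)).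
    by apply: cyc_swap => //; rewrite ?E_side //; lia.
  rewrite /cyc addSn /= !fan_nil cats0 cat0s in T.
  rewrite /thru !fanDl /=.
  have -> : l.+1 - (i + n) = (l.+1 - (i + n).+1).+1 by lia.
  rewrite -hopsS hopDn.
  rewrite !catA; do 2 apply: eqv_post.
  exact: eqv_sym.
- move=> i' j' l jl li ei ej _ _; subst.
  exists (thru i i.+1 i.+1 l); first exact: rep_thru.
  by rewrite /thru fan_nil subSnn hops1; apply: eqv_refl.
- move=> i' j' k ik kj ei ej _ _; subst; have -> : k = i.+1 by lia.
  exists (thru i i.+1 i.+1 i.+2); first exact: rep_thru.
  by rewrite /thru !fan_nil subSnn hops1; apply: eqv_refl.
Qed.

End NormalForms.

(** * Uniqueness of normal forms up to congruence *)

Section WalkClassification.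
Variables (n : nat) (s : {set 'I_n * 'I_n}).
Hypothesis n_ge3 : 2 < n.
Hypothesis sP : triangulation s.
Local Notation ed := (pedge n_ge3).
Local Notation E := (is_pedge s n_ge3).
Local Notation fan := (fan s n_ge3).
Local Notation hop := (hop s n_ge3).
Local Notation hops := (hops s n_ge3).
Local Notation thru := (thru s n_ge3).
Local Notation eqv := (eqv s n_ge3).
Local Notation cyc := (cyc s n_ge3).
Local Notation rep := (rep s n_ge3).

(** The full turn around [i] is moved past the fan, exchanged for one around [l], and the resulting
    bend at [(i, l)] is resolved by [fan_turn]. *)
Lemma thru_cyc_fan i j l : 0 < i -> i < j -> j <= l -> l < i + n -> E i j -> E i l ->
  eqv (ed i j) (thru i j l (i + n)) (cyc i j ++ fan i j l).
Proof.
move=> i0 ij jl li Eij Eil; rewrite cyc_fan //.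
have T := cyc_swap sP i0 (leq_trans ij jl) li Eil.
have Ep : E l.-1 l by rewrite EC E_pred //; lia.
have G : eqv (ed i j) (fan i j l ++ fan l i l.-1) (thru i j l.-1 l).
  by apply: fan_turn => //; lia.
apply/eqv_sym/(eqv_trans (q := fan i j l ++ cyc l (i + n))).
  by apply: eqv_pre; rewrite fan_last.
rewrite /cyc fan_pred ?catA; last lia.
rewrite -(catA _ (hop l)); apply: eqv_trans (eqv_post _ G) _.
rewrite /thru prednK ?fan_nil ?cats0 -?catA; last lia.
rewrite (catA _ (hop l)) -[hop l](hops1 s n_ge3).
have -> : l.+1 - j = (l - j) + 1 by lia.
by rewrite -hops_cat subnKC //; apply: eqv_refl.
Qed.

(** Across one hop, regrouping rebases the turn around [j] at the side [(j, j.+1)], and [cyc_swap]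
    makes it a turn around [j.+1]. *)
Lemma cyc_hops j r : 0 < j ->
  eqv (ed j.-1 j) (cyc j (j + n).-1 ++ hops j r) (hops j r ++ cyc (j + r) (j + r + n).-1).
Proof.
elim: r j => [|r IH] j j0; first by rewrite hops0 cats0 addn0; apply: eqv_refl.
have {IH} IH := IH j.+1 (ltn0Sn j).
rewrite (addSnnS j r) in IH; rewrite -hopsS -(catA (hop j)).
apply: eqv_trans (_ : eqv _ (hop j ++ cyc j.+1 (j.+1 + n).-1 ++ hops j.+1 r) _); last first.
  by apply: eqv_pre; rewrite hop_last.
have -> : cyc j (j + n).-1 ++ hop j ++ hops j.+1 r = hop j ++ cyc j j.+1 ++ hops j.+1 r.
  by rewrite /cyc !fan_nil cat0s cats0 -!catA.
apply: eqv_pre; rewrite hop_last; apply: eqv_post.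
by rewrite addSn /=; apply: cyc_swap => //; rewrite ?E_side //; lia.
Qed.

(** The lift of the target after [(k, l)] is [(l, k + n)], so the walk to it should be x times the
    walk to [(k, l)]. *)
Lemma thru_cyc i j k l z : 0 < i -> i < j -> j < i + n -> k < l -> l < k + n ->
  E i j -> E k l -> rep i j k l z ->
  eqv (ed i j) (thru i j l (k + n)) (cyc i j ++ z).
Proof.
move=> + + + + + + + r; case: r => {i j k l z}.
- move=> i j k l jk i0 ij ji kl lk Eij Ekl.
  have jl : fan j i j.-1 = fan j (i + n) (j + n).-1 by rewrite fan_pred //; lia.
  have lE : last (ed i j) (fan j i j.-1) = ed j.-1 j.
    rewrite jl edC -(edDr _ j) fan_last; last first.
    - by rewrite EC -(EDl _ _ _ j) ?EDr; have := E_side' s n_ge3 j; rewrite EC => h; rewrite EDl.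
    - by lia.
    by rewrite edC -ed_pred //; lia.
  (* The full turn is taken around [j], so that it passes the first fan; it is then pushed through
     the hops and absorbed into the final turn around [k] by [thru_cyc_fan]. *)
  apply: (eqv_trans (q := cyc j (i + n) ++ thru i j k l)); last first.
    by apply/eqv_post/eqv_sym/cyc_swap.
  rewrite {2}/thru catA jl cyc_fan; try lia.
  rewrite /thru -jl -catA; apply: eqv_pre; rewrite lE catA.
  apply: eqv_trans (eqv_post _ (eqv_sym (cyc_hops _ _))); last lia.
  have -> : j + (k.+1 - j) = k.+1 by lia.
  have -> : l.+1 - j = (k.+1 - j) + (l - k) by lia.
  rewrite -hops_cat -(catA _ (hops _ _)) -(catA _ (cyc _ _)).
  apply: eqv_pre; rewrite hops_last; last lia.
  have -> : j + (k.+1 - j) = k.+1 by lia.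
  have T := @thru_cyc_fan k k.+1 l.
  have {T} : eqv (ed k k.+1) (thru k k.+1 l (k + n)) (cyc k k.+1 ++ fan k k.+1 l).
    by apply: T; rewrite ?E_side //; lia.
  rewrite /thru fan_nil subSS cat0s => /eqv_trans; apply; apply: eqv_post.
  by rewrite addSn; apply: cyc_swap; rewrite ?E_side //; lia.
- move=> i j k l il i0 ij ji kl lk Eij Ekl.
  have Ei : E i (i + n).-1 by apply: E_side'.
  have T : eqv (ed i j) (thru i j (i + n).-1 (i + n)) (cyc i j ++ fan i j (i + n).-1).
    by apply: thru_cyc_fan => //; lia.
  rewrite {2}/thru fanDl !catA -(catA _ _ (fan l _ _)).
  apply: eqv_trans (eqv_post _ T).
  rewrite /thru prednK ?fan_nil ?cats0 -?catA; last lia.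
  have -> : l.+1 - j = (i + n - j) + (l.+1 - (i + n)) by lia.
  by rewrite -hops_cat subnKC -?catA; [apply: eqv_refl|lia].
- by move=> i j l jl li i0 ij ji il lin Eij Eil; apply: thru_cyc_fan.
- move=> i j k ik kj i0 ij ji _ jk Eij Ekj.
  apply: eqv_trans (eqv_post _ (eqv_sym (cyc_swap sP i0 ij ji Eij))).
  rewrite /thru /cyc fan_pred; last lia.
  rewrite subSnn hops1 -(fanDr _ _ j i k) -!catA fan_cat; [exact: eqv_refl|lia].
Qed.

Lemma rep_uniq i j k l p q : 0 < i -> i < j -> j < i + n -> k < l -> l < k + n ->
  E i j -> E k l -> rep i j k l p -> rep i j k l q -> eqv (ed i j) p q.
Proof.
(* Apart from two equal shapes or two empty turns, the only compatible pair of shapes consists of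
   the two boundary routes. *)
suff main i' j' k' l' : 0 < i' -> i' < j' -> j' < i' + n -> k' < l' -> l' < k' + n ->
    E i' j' -> E k' l' -> j' <= k' -> i' + n <= l' ->
    eqv (ed i' j') (thru i' j' k' l') (thru j' (i' + n) l' (k' + n)).
  have inv r : rep i j k l r -> [\/ j <= k /\ r = thru i j k l,
      i + n <= l /\ r = thru j (i + n) l (k + n),
      [/\ k = i, j <= l, l < i + n & r = fan i j l] |
      [/\ l = j, i <= k, k < j & r = fan j i k]].
    by case=> *; [constructor 1|constructor 2|constructor 3|constructor 4].
  move=> i0 ij ji kl lk Eij Ekl /inv[[jk ->]|[il ->]|[ki jl li ->]|[lj ik kj ->]]
    /inv[[jk' ->]|[il' ->]|[ki' jl' li' ->]|[lj' ik' kj' ->]];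
  try (exfalso; lia); try exact: eqv_refl.
  - exact: main.
  - exact/eqv_sym/main.
  - by subst; rewrite !fan_nil; apply: eqv_refl.
  - by subst; rewrite !fan_nil; apply: eqv_refl.
move=> i0 ij ji kl lk Eij Ekl jk il.
(* [(m, k')] is the lift of the target preceding [(k', l')], and it is still above [(i', j')]. With
   [z] a normal form to it, the routes are [z] preceded by the full turns around the two ends of the
   first edge. *)
have e : l' = l' - n + n by lia.
move: (l' - n) e => m el; subst l'.
have Emk : E m k' by rewrite EC -EDr.
have [z r] : exists z, rep i' j' m k' z by apply: rep_exists => //; lia.
have T1 : eqv (ed i' j') (thru i' j' k' (m + n)) (cyc i' j' ++ z).
  by apply: thru_cyc => //; lia.
apply: eqv_trans T1 _.
apply: eqv_trans (eqv_post _ (cyc_swap sP i0 ij ji Eij)) _.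
rewrite edC -(edDr _ j'); apply/eqv_sym/thru_cyc => //; try lia.
- by rewrite EDr EC.
- by apply: rep_swap => //; lia.
Qed.

End WalkClassification.

(** * Heights, drops and the reduction of walks *)

Section Drops.
Variables (n : nat) (s : {set 'I_n * 'I_n}).
Hypothesis n_ge3 : 2 < n.
Hypothesis sP : triangulation s.
Local Notation vx := (pvertex n_ge3).
Local Notation ed := (pedge n_ge3).
Local Notation E := (is_pedge s n_ge3).
Local Notation node := ('I_n * 'I_n)%type.
Local Notation fan := (fan s n_ge3).
Local Notation hop := (hop s n_ge3).
Local Notation hops := (hops s n_ge3).
Local Notation thru := (thru s n_ge3).
Local Notation eqv := (eqv s n_ge3).
Local Notation rep := (rep s n_ge3).

Definition height (x : node) : nat := x.1 + x.2.

(* The exponent of the monomial by which a walk acts: the number of arrows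
   along which the height decreases, each triangle and each big cycle
   containing exactly one of them. *)
Fixpoint drops (u : node) (p : seq node) : nat :=
  if p is v :: p' then (height v < height u) + drops v p' else 0.

Lemma drops_cat u p q : drops u (p ++ q) = drops u p + drops (last u p) q.
Proof. by elim: p u => //= v p IH u; rewrite IH addnA. Qed.

Definition walk (u : node) (p : seq node) := path (fun a b => arrow s (a, b)) u p.

(** The height is the sum of the two residues modulo [n], so an upward move can lose height only
    when a coordinate passes a multiple of [n]. *)
Lemma height_ed i j : height (ed i j) + (i %/ n + j %/ n) * n = i + j.
Proof.
have -> : height (ed i j) = i %% n + j %% n.
  by rewrite -!val_vx /height /pedge /seg; case: ifP => //= _; rewrite addnC.
by rewrite mulnDl {3}(divn_eq i n) {3}(divn_eq j n) addnACA [i %% n + _]addnC [j %% n + _]addnC.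
Qed.

Lemma divn_lt_succ i j : i <= j -> j < i + n -> j %/ n = i %/ n \/ j %/ n = (i %/ n).+1.
Proof.
move=> ij ji; have n0 : 0 < n by lia.
have h1 : i %/ n <= j %/ n by apply: leq_div2r.
have : j %/ n <= (i + n) %/ n by apply/leq_div2r/ltnW.
by rewrite divnDr // divnn n0; move: h1; move: (i %/ n) (j %/ n) => a b; lia.
Qed.

Lemma drop_int i j k : i < j -> j < k -> k < i + n ->
  (height (ed i k) < height (ed i j)) + j %/ n = k %/ n.
Proof.
move=> ij jk ki; have h1 := height_ed i j; have h2 := height_ed i k.
by have [||e|e] := @divn_lt_succ j k; lia.
Qed.

(** The height changes by 2 or by 2 - n, and the latter is a loss because n is at least 3. *)
Lemma drop_ext t : (height (ed t.+1 t.+2) < height (ed t t.+1)) + t %/ n + t.+1 %/ n =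
  t.+1 %/ n + t.+2 %/ n.
Proof.
have h1 := height_ed t t.+1; have h2 := height_ed t.+1 t.+2.
rewrite [RHS]addnC; congr (_ + _).
rewrite [_.+1 %/ _ + _]addnC in h2; rewrite !mulnDl !addnA in h1 h2.
by have [||e|e] := @divn_lt_succ t t.+2; lia.
Qed.

(** The last clause makes [drops] a function of the lifted ends. Replacing both lifts by their
    successors in the chain adds one to each side. *)
Definition lifts_to i j k l p := [/\ walk (ed i j) p, last (ed i j) p = ed k l &
  drops (ed i j) p + i %/ n + j %/ n = k %/ n + l %/ n].

Lemma lifts_nil i j : lifts_to i j i j [::].
Proof. by split. Qed.

Lemma lifts_cat i j k l i' j' p q :
  lifts_to i j k l p -> lifts_to k l i' j' q -> lifts_to i j i' j' (p ++ q).
Proof.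
case=> w1 e1 d1 [w2 e2 d2]; split; rewrite ?last_cat ?e1 ?drops_cat //.
  by rewrite /walk cat_path e1; apply/andP.
by rewrite e1; lia.
Qed.

Lemma lifts_swap i j k l p : lifts_to j (i + n) l (k + n) p <-> lifts_to i j k l p.
Proof.
have n0 : 0 < n by lia.
rewrite /lifts_to !edDr (edC _ j) (edC _ l) !divnDr // divnn n0.
by split=> -[? ? ?]; split=> //; lia.
Qed.

Lemma lifts_int i j k : i < j -> j < k -> k < i + n -> E i j -> E j k -> E i k ->
  lifts_to i j i k [:: ed i k].
Proof.
move=> ij jk ki h1 h2 h3; split=> //; first by rewrite /walk /= andbT arrow_int.
by rewrite /= -(drop_int ij jk ki); lia.
Qed.

Lemma lifts_int_lt i j k : j < k -> k < i -> i < j + n -> E i j -> E j k -> E i k ->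
  lifts_to j i k i [:: ed i k].
Proof.
move=> jk ki ij h1 h2 h3; apply/lifts_swap.
by rewrite -edDr; apply: lifts_int; rewrite ?EDr ?EDl //; lia.
Qed.

Lemma fan_lifts i j k : i < j -> j <= k -> k < i + n -> E i j -> E i k ->
  lifts_to i j i k (fan i j k).
Proof.
move=> ij jk ki Eij Eik.
(* Not every index is a neighbour of [i], so the induction on [k] tracks the last neighbour [t]
   reached. *)
suff [t [jt tk Eit nE]] : exists t, [/\ j <= t, t <= k, E i t,
    (forall t', t < t' -> t' <= k -> ~~ E i t') & lifts_to i j i t (fan i j k)].
  have [->//|tk'] := eqVneq k t.
  by move: (nE k); rewrite Eik leqnn; lia.
elim: k jk ki {Eik} => [|k IH] jk ki; first by lia.
have [ej|jk'] := eqVneq j k.+1.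
  by subst; exists k.+1; split=> //; [lia|rewrite fan_nil; apply: lifts_nil].
have [||t [jt tk Eit nE lt]] := IH; try lia.
rewrite -(fan_cat _ _ i (j := j) (m := k)); last lia.
rewrite fan1; case: ifP => Eik; last first.
  rewrite cats0; exists t; split=> //; first lia.
  move=> t' tt; rewrite leq_eqVlt => /orP[/eqP ->|]; first by rewrite Eik.
  exact: nE.
exists k.+1; split=> //; try lia.
apply: lifts_cat lt _; apply: lifts_int => //; try lia.
by apply: (E_consec sP (i := i)) => //; try lia; move=> t' h1 h2; apply: nE; lia.
Qed.

Lemma fan_lifts_lt i j k : j <= k -> k < i -> i < j + n -> E i j -> E i k ->
  lifts_to j i k i (fan i j k).
Proof.
move=> jk ki ij h1 h2; apply/lifts_swap.
by rewrite -fanDr; apply: fan_lifts; rewrite ?EDr //; lia.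
Qed.

Lemma has_diagP i j : i < j -> j < i + n -> E i j -> j != i.+1 -> j.+1 != i + n ->
  has_diag s (vx i).
Proof.
move=> ij ji + h1 h2; rewrite /is_pedge /is_edge side_ed; last lia.
rewrite (negbTE h1) (negbTE h2) /= => es; apply/existsP; exists (ed i j); rewrite es /=.
by rewrite /pedge /seg; case: ifP => _; rewrite eqxx ?orbT.
Qed.

Lemma hop_lifts m : 0 < m -> lifts_to m.-1 m m m.+1 (hop m).
Proof.
case: m => // m _; rewrite /hop; case: ifP => hd /=.
  split=> //; first by rewrite /walk /= andbT arrow_ext.
  by have := drop_ext m; rewrite /=; lia.
rewrite edDl.
(* Without a diagonal at [m.+1], its neighbours [m.+2] and [m + n] are consecutive and so are joined
   by an edge. *)
have Em2 : E m m.+2.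
  rewrite EC -EDr; apply: (E_consec sP (i := m.+1)); rewrite ?E_side //; try lia.
    by have := E_side' s n_ge3 m.+1; rewrite addSn.
  move=> t h1 h2; apply/negP => Et; suff: has_diag s (vx m.+1) by rewrite hd.
  by apply: (has_diagP _ _ Et); lia.
rewrite -[[:: ed m m.+2; _]]/([:: ed m m.+2] ++ _).
apply: (@lifts_cat _ _ m m.+2); first by apply: lifts_int; rewrite ?E_side //; lia.
rewrite (edC _ m.+1); apply: lifts_int_lt; rewrite ?E_side // 1?EC ?E_side //; lia.
Qed.

Lemma hops_lifts m r : 0 < m -> lifts_to m.-1 m (m + r).-1 (m + r) (hops m r).
Proof.
elim: r m => [|r IH] m m0; first by rewrite addn0; apply: lifts_nil.
rewrite -hopsS; apply: lifts_cat (hop_lifts m0) _.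
by rewrite -addSnnS; apply: (IH m.+1).
Qed.

Lemma thru_lifts i j k l : 0 < i -> i < j -> j < i + n -> j <= k -> k < l -> l < k + n ->
  E i j -> E k l -> lifts_to i j k l (thru i j k l).
Proof.
move=> i0 ij ji jk kl lk Eij Ekl.
apply: (@lifts_cat _ _ j.-1 j).
  by apply: fan_lifts_lt; rewrite ?E_pred // 1?EC //; lia.
apply: (@lifts_cat _ _ k k.+1).
  have := @hops_lifts j (k.+1 - j); rewrite subnKC /=; last lia.
  by apply; lia.
by apply: fan_lifts; rewrite ?E_side.
Qed.

Lemma rep_lifts i j k l p : 0 < i -> i < j -> j < i + n -> k < l -> l < k + n ->
  E i j -> E k l -> rep i j k l p -> lifts_to i j k l p.
Proof.
move=> + + + + + + + r; case: r => {i j k l p}.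
- by move=> i j k l *; apply: thru_lifts.
- move=> i j k l il i0 ij ji kl lk Eij Ekl; apply/lifts_swap.
  by apply: thru_lifts; rewrite ?EDr //; try lia; rewrite EC.
- by move=> i j l *; apply: fan_lifts.
- by move=> i j k *; apply: fan_lifts_lt => //; rewrite EC.
Qed.

(** Both sides of the triangle relation lead from the lift [(j, m)] to the lift [(m, k)], hence have
    equally many drops. *)
Lemma eqv_walk u p q : eqv u p q ->
  [/\ walk u p = walk u q, last u p = last u q & drops u p = drops u q].
Proof.
elim=> {u p q} //=.
- by move=> u p q _ [-> -> ->].
- by move=> u p q r _ [-> -> ->] _ [-> -> ->].
- by move=> u v p q _ [w -> ->]; rewrite /walk /= -!/(walk _ _) w.
- move=> u p q r _ [w e d].
  by rewrite /walk !cat_path -!/(walk _ _) w e !last_cat e !drops_cat d e.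
- move=> j m k jm mk kj Ejm Emk Ejk; have n0 : 0 < n by lia.
  have [w1 e1 d1] : lifts_to j m m k ([:: ed j k] ++ [:: ed k m]).
    apply: (@lifts_cat _ _ j k); first exact: lifts_int.
    by apply: lifts_int_lt => //; rewrite EC.
  have [w2 e2 d2] : lifts_to j m m k (fan m j m.-1 ++ hop m ++ fan m m.+1 k).
    apply: (@lifts_cat _ _ m.-1 m).
      by apply: fan_lifts_lt; rewrite ?E_pred // 1?EC //; lia.
    apply: lifts_cat (hop_lifts _) _; first lia.
    by apply: fan_lifts; rewrite ?E_side //; lia.
  rewrite cat1s (edC _ k m) in w1 d1.
  split; [by rewrite w2; apply: w1|by rewrite e2|].
  by apply: (@addIn (j %/ n + m %/ n)); rewrite [RHS]addnA d2 -d1 -[RHS]addnA.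
Qed.

(** Arrows are prepended one at a time to a normal form. A turn around [j] is a turn around the
    first end in the lift [(j, i + n)], so only turns around [i] and hops need treatment. *)
Lemma walk_rep i j p : 0 < i -> i < j -> j < i + n -> E i j -> walk (ed i j) p ->
  exists k l q, [/\ [/\ i <= k, j <= l, k < l & l < k + n], E k l,
    lifts_to i j k l p, rep i j k l q & eqv (ed i j) p q].
Proof.
pose Q i j p := exists k l q, [/\ [/\ i <= k, j <= l, k < l & l < k + n], E k l,
    lifts_to i j k l p, rep i j k l q & eqv (ed i j) p q].
have Qswap i' j' p' : 0 < i' -> i' < j' -> Q j' (i' + n) p' -> Q i' j' p'.
  move=> i0 ij [k [l [q [[jk il kl lk] Ekl lt r e]]]].
  exists (l - n), k, q; have el : l = l - n + n by lia.
  rewrite el in Ekl lt r; split; first by split; lia.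
  - by rewrite EC -EDr.
  - exact/lifts_swap.
  - by apply: rep_unswap => //; lia.
  - by rewrite edDr edC in e.
elim: p i j => [|b p IH] i j i0 ij ji Eij.
  move=> _; exists i, j, [::]; split; [by split|by []|exact: lifts_nil| |exact: eqv_refl].
  by rewrite -(fan_nil s n_ge3 i j); apply: rep_fanl.
rewrite /walk /= -/(walk _ _) => /andP[ab w].
have Qint i' j' k' : 0 < i' -> i' < j' -> j' < k' -> k' < i' + n -> E i' j' -> E j' k' ->
    E i' k' -> b = ed i' k' -> Q i' j' (b :: p).
  move=> i0' ij' jk' ki' Eij' Ejk' Eik' eb.
  rewrite eb in w *.
  have [|k [l [q [[h1 h2 h3 h4] Ekl lt r e]]]] := IH i' k' i0' _ ki' Eik' w; first lia.
  have [q' r' e'] := fan_rep sP ij' (ltnW jk') ki' h3 Eij' Eik' Ekl r.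
  exists k, l, q'; split=> //; first by split=> //; lia.
    rewrite -cat1s; apply: lifts_cat lt.
    exact: lifts_int.
  apply: eqv_trans e'; rewrite (fan_consec sP) //.
  exact: eqv_cons.
have Qext t : 0 < t -> has_diag s (vx t.+1) -> b = ed t.+1 t.+2 -> Q t t.+1 (b :: p).
  move=> t0 hd eb; rewrite eb in w *.
  have [||||k [l [q [[h1 h2 h3 h4] Ekl lt r e]]]] := IH t.+1 t.+2 _ _ _ _ w;
    rewrite ?E_side //; try lia.
  have [q' r' e'] := hop_rep sP t0 h3 h4 r.
  exists k, l, q'; split=> //; first by split=> //; lia.
    rewrite -cat1s; apply: lifts_cat lt.
    by have := @hop_lifts t.+1; rewrite /hop hd; apply.
  apply: eqv_trans e'; rewrite /hop hd.
  exact: eqv_cons.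
have ijn : i < j < i + n by rewrite ij.
case: (arrow_inv sP ijn ab) => [[k [jk ki Ejk Eik eb]]|[k [ik kj Eik Ejk eb]]|[t [et hd eb]]].
- exact: Qint eb.
- apply: Qswap => //; apply: Qint eb; rewrite ?EDr ?EDl //; try lia.
  by rewrite EC.
- case/orP: et => /eqP[e1 e2]; first by subst; apply: Qext.
  by apply: Qswap => //; rewrite e2 -e1; subst t; apply: Qext => //; lia.
Qed.

End Drops.

(** * Cyclic derivatives of the cyclic triangles *)

Section CyclicDerivatives.
Variables (n : nat) (s : {set 'I_n * 'I_n}).
Local Notation node := ('I_n * 'I_n)%type.

Lemma flatten_map_nil (S T : eqType) (f : S -> seq T) (r : seq S) :
  {in r, forall y, f y = [::]} -> flatten [seq f y | y <- r] = [::].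
Proof.
elim: r => //= y r IH f0; rewrite f0 ?inE ?eqxx // IH // => z zr.
by rewrite f0 // inE zr orbT.
Qed.

Lemma flatten_map_single (S T : eqType) (f : S -> seq T) (r : seq S) x :
  uniq r -> x \in r -> {in r, forall y, y != x -> f y = [::]} ->
  flatten [seq f y | y <- r] = f x.
Proof.
elim: r => //= y r IH /andP[yr ur]; rewrite inE => /predU1P[->|xr] f0.
  rewrite flatten_map_nil ?cats0 // => z zr.
  by apply: f0; rewrite ?inE ?zr ?orbT //; apply: contraNneq yr => <-.
rewrite f0 ?inE ?eqxx //; last by apply: contraNneq yr => ->.
by apply: IH => // z zr; apply: f0; rewrite inE zr orbT.
Qed.

Lemma flatten_map_flatten (S T : Type) (f : S -> seq T) (rs : seq (seq S)) :
  flatten [seq f y | y <- flatten rs] =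
  flatten [seq flatten [seq f y | y <- r] | r <- rs].
Proof. by elim: rs => //= r rs IH; rewrite map_cat flatten_cat IH. Qed.

Lemma dcyc_notin (a : node * node) c : a \notin c -> dcyc a c = [::].
Proof.
move=> ac; rewrite /dcyc (eq_in_filter (a2 := pred0)) ?filter_pred0 // => i.
by rewrite mem_iota add0n => /= ic; apply: contraNF ac => /eqP <-; apply: mem_nth.
Qed.

Lemma dcyc_cat (a : node * node) c1 c2 : a \notin c1 -> a \notin c2 ->
  dcyc a (c1 ++ a :: c2) = [:: (a.2, c2 ++ c1)].
Proof.
move=> a1 a2; rewrite /dcyc size_cat /= iotaD add0n filter_cat map_cat /=.
rewrite nth_cat ltnn subnn eqxx /= (eq_in_filter (a2 := pred0)); last first.
  move=> i; rewrite mem_iota add0n /= => ic; rewrite nth_cat ic.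
  by apply: contraNF a1 => /eqP <-; apply: mem_nth.
rewrite filter_pred0 /= (eq_in_filter (a2 := pred0)); last first.
  move=> i; rewrite mem_iota => /andP[i1 i2].
  rewrite nth_cat ltnNge (ltnW i1) /= -subnSK //=.
  by apply: contraNF a2 => /eqP <-; apply: mem_nth; rewrite ltn_subLR.
by rewrite filter_pred0 /= take_size_cat // -cat_rcons drop_size_cat ?size_rcons.
Qed.

Definition arr (u : node) (p : seq node) := pairmap pair u p.

Lemma arr_cat u p q : arr u (p ++ q) = arr u p ++ arr (last u p) q.
Proof. exact: pairmap_cat. Qed.

Lemma arr_zip u p : zip (u :: p) p = arr u p.
Proof. by elim: p u => //= v p IH u; rewrite IH. Qed.

Lemma arr_snd u p : [seq x.2 | x <- arr u p] = p.
Proof. by elim: p u => //= v p IH u; rewrite IH. Qed.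

Lemma arr_fst u p : [seq x.1 | x <- arr u p] = belast u p.
Proof. by elim: p u => //= v p IH u; rewrite IH. Qed.

(** The two edges joined by an arrow already involve all three corners of the triangle, and the
    increasing order fixes which is which. *)
Lemma tricycle_inj (b : node * node) (i j k i' j' k' : 'I_n) :
  i < j -> j < k -> i' < j' -> j' < k' ->
  b \in tricycle i j k -> b \in tricycle i' j' k' -> [/\ i' = i, j' = j & k' = k].
Proof.
move=> ij jk ij' jk'; rewrite !inE.
by move=> /or3P[] /eqP -> /or3P[] /eqP [] /seg_inj e1 /seg_inj e2;
  case: e1 => -[? ?]; case: e2 => -[? ?]; subst; split=> //; apply: val_inj; lia.
Qed.

Lemma tricycle_uniq (i j k : 'I_n) : i < j -> j < k -> uniq (tricycle i j k).
Proof.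
move=> ij jk; rewrite /tricycle /= !inE !negb_or !andbT -andbA.
by apply/and3P; split; apply/eqP => -[/seg_inj e _]; case: e => -[? ?]; subst; lia.
Qed.

Lemma dcyc_tricycles (b : node * node) (i j k : 'I_n) :
  i < j -> j < k -> is_tri s i j k -> b \in tricycle i j k ->
  flatten [seq dcyc b c | c <- tricycles s] = dcyc b (tricycle i j k).
Proof.
move=> ij jk t bt.
have nil (i' j' k' : 'I_n) : i' < j' -> j' < k' -> [|| i' != i, j' != j | k' != k] ->
    dcyc b (tricycle i' j' k') = [::].
  move=> h1 h2 ne; apply: dcyc_notin; apply/negP => bt'.
  by case: (tricycle_inj ij jk h1 h2 bt bt') ne => -> -> ->; rewrite !eqxx.
rewrite /tricycles flatten_map_flatten -map_comp /=.
rewrite (@flatten_map_single _ _ _ _ i) ?enum_uniq ?mem_enum //; last first.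
  move=> i' _ ni /=; rewrite flatten_map_flatten -map_comp; apply: flatten_map_nil => j'.
  rewrite mem_filter => /andP[h1 _] /=; rewrite -map_comp; apply: flatten_map_nil => k'.
  by rewrite mem_filter => /andP[/andP[h2 _] _] /=; apply: nil; rewrite ?ni.
rewrite /= flatten_map_flatten -map_comp.
have jP : j \in [seq j : 'I_n <- enum 'I_n | i < j] by rewrite mem_filter ij mem_enum.
have kP : k \in [seq k : 'I_n <- enum 'I_n | (j < k) && is_tri s i j k].
  by rewrite mem_filter jk t mem_enum.
rewrite (flatten_map_single (filter_uniq _ (enum_uniq _)) jP) /=; last first.
  move=> j'; rewrite mem_filter => /andP[h1 _] nj /=.
  rewrite -map_comp; apply: flatten_map_nil => k'.
  by rewrite mem_filter => /andP[/andP[h2 _] _] /=; apply: nil; rewrite ?nj ?orbT.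
rewrite -map_comp (flatten_map_single (filter_uniq _ (enum_uniq _)) kP) //.
move=> k'; rewrite mem_filter => /andP[/andP[h2 _] _] nk /=.
by apply: nil; rewrite ?nk ?orbT.
Qed.

Lemma dcyc_tricycle0 (i j k : 'I_n) : i < j -> j < k -> dcyc (seg i j, seg i k) (tricycle i j k) =
  [:: (seg i k, [:: (seg i k, seg j k); (seg j k, seg i j)])].
Proof.
move=> ij jk; have := tricycle_uniq ij jk; rewrite /tricycle cons_uniq => /andP[h _].
exact: (dcyc_cat (c1 := [::])).
Qed.

Lemma dcyc_tricycle1 (i j k : 'I_n) : i < j -> j < k -> dcyc (seg i k, seg j k) (tricycle i j k) =
  [:: (seg j k, [:: (seg j k, seg i j); (seg i j, seg i k)])].
Proof.
move=> ij jk; have := tricycle_uniq ij jk.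
rewrite /tricycle -[[:: _, _ & _]]/([:: (seg i j, seg i k)] ++ _ :: _) uniq_catC.
rewrite cons_uniq /= !inE negb_or => /andP[/andP[h1 h2] _].
by apply: (dcyc_cat (c1 := [:: _]) (c2 := [:: _])); rewrite inE.
Qed.

Lemma dcyc_tricycle2 (i j k : 'I_n) : i < j -> j < k -> dcyc (seg j k, seg i j) (tricycle i j k) =
  [:: (seg i j, [:: (seg i j, seg i k); (seg i k, seg j k)])].
Proof.
move=> ij jk; have := tricycle_uniq ij jk.
rewrite /tricycle -[[:: _, _ & _]]/([:: (seg i j, seg i k); (seg i k, seg j k)] ++ [:: _]).
rewrite uniq_catC cons_uniq => /andP[h1 _].
exact: (dcyc_cat (c1 := [:: _; _]) (c2 := [::])).
Qed.
End CyclicDerivatives.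

(** * The generators of the ideal in lifted coordinates *)

Section Relations.
Variables (n : nat) (s : {set 'I_n * 'I_n}).
Hypothesis n_ge3 : 2 < n.
Hypothesis sP : triangulation s.
Local Notation vx := (pvertex n_ge3).
Local Notation ed := (pedge n_ge3).
Local Notation E := (is_pedge s n_ge3).
Local Notation fan := (fan s n_ge3).
Local Notation hop := (hop s n_ge3).

Lemma dcyc_tricycles_ed j m k : j < m -> m < k -> k < j + n -> E j m -> E m k -> E j k ->
  flatten [seq dcyc (ed m k, ed j m) c | c <- tricycles s] =
  [:: (ed j m, arr (ed j m) [:: ed j k; ed m k])].
Proof.
elim/(lift_redP n_ge3): j => j q jn jm mk kj.
have [|m0 em _] := @shift_le _ n_ge3 j (q * n) m; first by lia.
have [|k0 ek _] := @shift_le _ n_ge3 j (q * n) k; first by lia.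
subst m k; rewrite !EDMn !edDMn.
have {jm} jm : j < m0 by lia.
have {mk} mk : m0 < k0 by lia.
have {kj} kj : k0 < j + n by lia.
move: m0 k0 jm mk kj => m k jm mk kj Ejm Emk Ejk.
have [Ekj Ekm Emj] : [/\ E k j, E k m & E m j] by split; rewrite EC.
have [vj vm vk] : [/\ vx j = j :> nat, vx m = (if m < n then m else m - n) :> nat &
    vx k = (if k < n then k else k - n) :> nat].
  by split; [apply: val_vx_small|apply: val_vx2; lia|apply: val_vx2; lia].
(* Which corners wrap past [n] decides the corner of smallest label, and so the position in
   [tricycle] of the arrow at the corner [m]. *)
have [kn|nk] := ltnP k n.
  rewrite kn in vk; rewrite (ltn_trans mk kn) in vm.
  have [h1 h2] : vx j < vx m /\ vx m < vx k by rewrite vj vm vk.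
  have t : is_tri s (vx j) (vx m) (vx k) by rewrite (is_tri_ed n_ge3 sP) Ejm Emk Ejk.
  by rewrite (dcyc_tricycles h1 h2 t) ?dcyc_tricycle2 // !inE eqxx !orbT.
have [mn|nm] := ltnP m n.
  rewrite ltnNge nk /= in vk; rewrite mn in vm.
  have [h1 h2] : vx k < vx j /\ vx j < vx m by rewrite vj vm vk; lia.
  have t : is_tri s (vx k) (vx j) (vx m).
    by rewrite (is_tri_ed n_ge3 sP) Ekj Ejm Ekm.
  rewrite /pedge (segC (vx m)) (segC (vx j) (vx k)).
  by rewrite (dcyc_tricycles h1 h2 t) ?dcyc_tricycle1 // !inE eqxx ?orbT.
rewrite ltnNge nk /= in vk; rewrite ltnNge nm /= in vm.
have [h1 h2] : vx m < vx k /\ vx k < vx j by rewrite vj vm vk; lia.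
have t : is_tri s (vx m) (vx k) (vx j).
  by rewrite (is_tri_ed n_ge3 sP) Emk Ekj Emj.
rewrite /pedge (segC (vx j) (vx m)) (segC (vx j) (vx k)).
by rewrite (dcyc_tricycles h1 h2 t) ?dcyc_tricycle0 // !inE eqxx ?orbT.
Qed.

Lemma ed_inj m t t' : m < t -> t < m + n -> m < t' -> t' < m + n ->
  ed m t = ed m t' -> t = t'.
Proof.
move=> h1 h2 h3 h4 e; have {e} /eqP : vx t = vx t'.
  by case: (seg_inj e) => -[e1 e2]; rewrite ?e2 -?e1.
have [le|/ltnW le] := leqP t t'; last rewrite eq_sym.
  by rewrite vx_eq; [move/eqP|lia].
by rewrite vx_eq; [move/eqP|lia].
Qed.

Lemma fan_uniq m j k : m <= j -> k < m + n -> uniq (fan m j k).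
Proof.
move=> mj km; rewrite /fan map_inj_in_uniq ?filter_uniq ?iota_uniq //.
move=> t t'; rewrite !mem_filter !mem_iota => /andP[_ h1] /andP[_ h2].
by apply: ed_inj; lia.
Qed.

(** The neighbours of the vertex [m] lift uniquely strictly between [m] and [m + n], and there [rot]
    is the distance from [m]: both lists are sorted by it and have the same elements. *)
Lemma nbr_edges_fan m : nbr_edges s (vx m) = fan m m (m + n).-1.
Proof.
pose le (j k : 'I_n) := Defs.rot (vx m) j <= Defs.rot (vx m) k.
rewrite /nbr_edges -[sort _ _]/(sort le _).
suff -> : sort le [seq j <- enum 'I_n | (j != vx m) && is_edge s (seg (vx m) j)] =
    [seq vx t | t <- iota m.+1 ((m + n).-1 - m) & E m t].
  by rewrite -map_comp.
have inj : {in [pred t | m < t < m + n] &, injective vx}.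
  move=> t t'; rewrite !inE => h1 h2 /eqP.
  have [le'|/ltnW le'] := leqP t t'; last rewrite eq_sym.
    by rewrite vx_eq; [move/eqP|lia].
  by rewrite vx_eq; [move/eqP|lia].
apply: (sorted_eq (leT := le)).
- by move=> x y z; apply: leq_trans.
- move=> x y /andP[]; rewrite /le => h1 h2.
  have [t ht ex] := exists_lift n_ge3 m x; have [t' ht' ey] := exists_lift n_ge3 m y.
  by subst x y; rewrite !rot_vx // in h1 h2; congr vx; lia.
- by apply: sort_sorted => x y; apply: leq_total.
- rewrite sorted_map; apply: (sub_in_sorted (P := [pred t | m < t < m + n]) (e := leq)).
  + move=> t t'; rewrite !inE => h1 h2 le'; rewrite /relpre /= /le !rot_vx; lia.
  + apply/allP => t; rewrite mem_filter mem_iota inE; lia.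
  + by apply: sorted_filter; [apply: leq_trans|apply: iota_sorted].
- apply: perm_trans (permEl (perm_sort _ _)) _; apply: uniq_perm.
  + by rewrite filter_uniq ?enum_uniq.
  + rewrite map_inj_in_uniq ?filter_uniq ?iota_uniq // => t t'.
    rewrite !mem_filter !mem_iota => /andP[_ h1] /andP[_ h2]; apply: inj; rewrite inE; lia.
move=> x; rewrite mem_filter mem_enum andbT; apply/andP/mapP => [[nx ex]|[t]].
  have [t ht et] := exists_lift n_ge3 m x; subst x; exists t => //.
  rewrite mem_filter mem_iota; apply/andP; split; first exact: ex.
  by have : t != m by [apply: contraNneq nx => ->]; lia.
rewrite mem_filter mem_iota => /andP[Et ht] ->; split; last exact: Et.
by rewrite eq_sym vx_eq; lia.
Qed.

Lemma bigcycle_arr m : bigcycle s (vx m) =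
  (ed m (m + n).-1, ed m m.+1) :: arr (ed m m.+1) (fan m m.+1 (m + n).-1).
Proof.
rewrite /bigcycle nbr_edges_fan -(fan_cat _ _ m (j := m) (m := m.+1)); last lia.
by rewrite fan1 E_side cat1s arr_zip fan_last ?E_side' //; lia.
Qed.

Lemma bigcycle_nbr (i : 'I_n) x : x \in bigcycle s i ->
  (exists y, x.1 = seg i y) /\ (exists y, x.2 = seg i y).
Proof.
have nbr y : y \in nbr_edges s i -> exists z, y = seg i z by case/mapP=> z _ ->; exists z.
rewrite /bigcycle; case: (nbr_edges s i) nbr => // f0 fs nbr.
rewrite arr_zip => xb; split; apply: nbr.
  have : x.1 \in last f0 fs :: belast f0 fs.
    by rewrite -(arr_fst f0 fs); apply: (map_f fst xb).
  by rewrite (lastI f0 fs) mem_rcons.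
by have := map_f snd xb; rewrite /= arr_snd.
Qed.

(** The two edges have only the vertex [m] in common, so no other big cycle contains the arrow. As
    [k] and [j + n] are consecutive neighbours of [m], cutting the cycle there leaves a turn, the
    external arrow and a turn. *)
Lemma dcyc_bigcycles j m k : j < m -> m < k -> k < j + n ->
  E j m -> E m k -> E j k -> has_diag s (vx m) ->
  flatten [seq dcyc (ed m k, ed j m) c
            | c <- [seq bigcycle s i | i <- [seq i <- enum 'I_n | has_diag s i]]] =
  [:: (ed j m, arr (ed j m) (fan m j m.-1 ++ hop m ++ fan m m.+1 k))].
Proof.
move=> jm mk kj Ejm Emk Ejk hd.
have mP : vx m \in [seq i <- enum 'I_n | has_diag s i] by rewrite mem_filter hd mem_enum.
rewrite -map_comp (flatten_map_single (filter_uniq _ (enum_uniq _)) mP) /=; last first.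
  move=> i _ im; apply: dcyc_notin; apply: contra_neqN im => /bigcycle_nbr[[y e1] [z e2]].
  have jk : vx j != vx k by rewrite vx_eq; lia.
  case: (seg_inj e1) => -[e3 e4] //; case: (seg_inj e2) => -[e5 e6] //.
  by rewrite e4 e5 eqxx in jk.
have Ekm : E k m by rewrite EC.
have fE : fan m m.+1 (m + n).-1 = fan m m.+1 k ++ ed j m :: fan m j m.-1.
  rewrite -(fan_cat _ _ m (j := m.+1) (m := k) (k := (m + n).-1)); last lia.
  congr (_ ++ _); rewrite -(fan_cat _ _ m (j := k) (m := j + n)); last lia.
  rewrite (fan_consec sP) ?EDr 1?(EC _ _ m) // 1?(EC _ _ k) //; try lia.
  by rewrite fan_pred ?edDr 1?edC //; lia.
have lE : last (ed m m.+1) (fan m m.+1 k) = ed m k by rewrite fan_last.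
have bE : bigcycle s (vx m) =
    ((ed m (m + n).-1, ed m m.+1) :: arr (ed m m.+1) (fan m m.+1 k)) ++
    (ed m k, ed j m) :: arr (ed j m) (fan m j m.-1).
  by rewrite bigcycle_arr fE arr_cat lE.
have : uniq (bigcycle s (vx m)).
  apply: (@map_uniq _ _ snd); rewrite bigcycle_arr /= arr_snd.
  have := @fan_uniq m m (m + n).-1 (leqnn m); rewrite -(fan_cat _ _ m (j := m) (m := m.+1)).
    by rewrite fan1 E_side; apply; lia.
  by lia.
rewrite bE cat_uniq cons_uniq => /and4P[_ ndis n2 _].
rewrite dcyc_cat //; last first.
  by apply: contra ndis => h; apply/hasP; exists (ed m k, ed j m) => //; apply: mem_head.
rewrite /hop hd arr_cat; congr [:: (_, _ ++ _)].
have -> : last (ed j m) (fan m j m.-1) = ed m (m + n).-1.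
  rewrite (edC _ j) fan_last ?E_pred //; try lia.
  by rewrite (edC _ m (m + n).-1) ed_pred 1?edC //; lia.
by [].
Qed.

(** Link between potential and congruence: the two terms, with opposite signs, are the two sides of
    [eqv_tri]. *)
Lemma potential_derivative (K : fieldType) j m k : j < m -> m < k -> k < j + n ->
  E j m -> E m k -> E j k -> has_diag s (vx m) ->
  dW s K (ed m k, ed j m) =
  [:: (1%R, (ed j m, arr (ed j m) [:: ed j k; ed m k]));
      (-1, (ed j m, arr (ed j m) (fan m j m.-1 ++ hop m ++ fan m m.+1 k)))]%R.
Proof.
move=> jm mk kj Ejm Emk Ejk hd.
have scal (S : Type) (c : K) (f : S -> seq (qpath n)) r :
    flatten [seq [seq (c, p) | p <- f w] | w <- r] = [seq (c, p) | p <- flatten [seq f w | w <- r]].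
  by rewrite map_flatten -map_comp.
rewrite /dW /potential map_cat flatten_cat -!map_comp.
rewrite (scal _ 1%R (fun c => dcyc _ c)) dcyc_tricycles_ed //.
rewrite (scal _ (-1)%R (fun i => dcyc _ (bigcycle s i))).
by have := dcyc_bigcycles jm mk kj Ejm Emk Ejk hd; rewrite -map_comp => ->.
Qed.

(** External arrows join two sides, so an eligible arrow is internal; one of its edges is a
    diagonal, which ends at the common corner. *)
Lemma eligible_triangle a : eligible s a -> exists j m k, [/\ [/\ j < m, m < k & k < j + n],
  [/\ E j m, E m k & E j k], has_diag s (vx m) & a = (ed m k, ed j m)].
Proof.
case: a => a1 a2 /andP[/orP[/= | /=]].
  case/existsP=> x /existsP[y /existsP[z /and4P[t /eqP e1 /eqP e2 lt]]] ns; subst a1 a2.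
  (* The shift by [n] makes room below [m] for the corner [l - n]. *)
  pose m := x + n; have ex : x = vx m by rewrite vxDn vx_val.
  have [k hk ey] := exists_lift n_ge3 m y; have [l hl ez] := exists_lift n_ge3 m z.
  move: t lt ns; rewrite ex ey ez is_tri_ed // !rot_vx // => /and3P[Emk Ekl Eml] lt ns.
  have km : m != k by apply: contraTneq Emk => <-; apply/negP => /(E_neq sP); rewrite eqxx.
  have el : l = l - n + n by lia.
  exists (l - n), m, k; rewrite el EDr in Ekl; rewrite el EDr in Eml; split; first by split; lia.
  - by split=> //; rewrite EC.
  - move: ns; rewrite -/(ed m k) -/(ed m l) !side_ed; try lia.
    case/orP=> /norP[h1 h2]; first by apply: (has_diagP _ _ Emk); lia.
    by rewrite -EDr -el in Eml; apply: (has_diagP _ _ Eml); lia.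
  - by rewrite (edC _ (l - n)) -(edDr _ m (l - n)) -el.
case/existsP=> x /existsP[y /existsP[z /and5P[_ /eqP xy /eqP yz /eqP -> /eqP ->]]].
have sd (u v : 'I_n) : u.+1 %% n = v -> is_side (seg u v).
  move=> e; rewrite is_side_seg e eqxx /=.
  have [t _ eu] := exists_lift n_ge3 0 u; subst u.
  have -> : v = vx t.+1 by apply: val_inj; rewrite /= -e succ_vx.
  by rewrite vx_eq; lia.
by rewrite !sd.
Qed.

End Relations.

(** * Walks with given ends and number of drops *)

Section WalksByDrops.
Variables (n : nat) (s : {set 'I_n * 'I_n}).
Hypothesis n_ge3 : 2 < n.
Hypothesis sP : triangulation s.
Local Notation vx := (pvertex n_ge3).
Local Notation ed := (pedge n_ge3).
Local Notation E := (is_pedge s n_ge3).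
Local Notation node := ('I_n * 'I_n)%type.
Local Notation eqv := (eqv s n_ge3).

Lemma is_edge_lt (u : node) : is_edge s u -> u.1 < u.2.
Proof. by have [sd _ _] := sP; case/orP=> [/andP[]|/sd /andP[]]. Qed.

Lemma ed_lift (u : node) q : u.1 < u.2 -> ed (u.1 + q * n) (u.2 + q * n) = u.
Proof. by rewrite edDMn /pedge !vx_val /seg; case: u => x y /= ->. Qed.

Lemma ed_lift_swap (u : node) q : u.1 < u.2 -> ed (u.2 + q * n) (u.1 + q.+1 * n) = u.
Proof. by move=> lt; rewrite mulSn (addnC n) addnA edDr edC ed_lift. Qed.

Lemma ord_div (x : 'I_n) q : (x + q * n) %/ n = q.
Proof. by rewrite addnC divnMDl ?divn_small ?addn0 //; lia. Qed.

Lemma ed_lift1 (u : node) : u.1 < u.2 -> ed (u.1 + n) (u.2 + n) = u.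
Proof. by move=> lt; have := ed_lift 1 lt; rewrite mul1n. Qed.

Lemma ord_div1 (x : 'I_n) : (x + n) %/ n = 1.
Proof. by have := ord_div x 1; rewrite mul1n. Qed.

Lemma liftP k l (v : node) : k < l -> l < k + n -> v.1 < v.2 -> ed k l = v ->
  exists q, (k = v.1 + q * n /\ l = v.2 + q * n) \/ (k = v.2 + q * n /\ l = v.1 + q.+1 * n).
Proof.
move=> kl lk; case: v => x y /= xy ev; exists (k %/ n).
have {ev} ev : seg (vx k) (vx l) = seg x y by rewrite -/(ed k l) ev /seg xy.
have n0 : 0 < n by lia.
have [le|le] := divn_lt_succ n_ge3 (ltnW kl) lk; have ek := divn_eq k n; have el := divn_eq l n;
  have rk : k %% n < n by [rewrite ltn_pmod]; have rl : l %% n < n by [rewrite ltn_pmod];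
  rewrite le in el; have vk := val_vx n_ge3 k; have vl := val_vx n_ge3 l;
  case: (seg_inj ev) => -[e1 e2]; rewrite ?e1 ?e2 in vk vl.
- by left; rewrite vk vl; lia.
- by exfalso; move: kl; rewrite ek el -vk -vl ltn_add2l; lia.
- by exfalso; move: lk; rewrite ek el -vk -vl mulSn; lia.
- by right; rewrite vk vl; lia.
Qed.

(** The position in the chain [(v.1, v.2)], [(v.2, v.1 + n)], [(v.1 + n, v.2 + n)] of the first lift
    of [v] that dominates [(u.1, u.2)] in both coordinates; the third always does. *)
Definition expo (u v : node) : nat :=
  if (u.1 <= v.1) && (u.2 <= v.2) then 0 else if u.1 <= v.2 then 1 else 2.

(** Starting from the lift shifted by [n] keeps the indices positive, and accounts for the summand
    2. *)
Lemma walk_lift u p : is_edge s u -> walk s u p -> exists k l q,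
  [/\ [/\ u.1 + n <= k, u.2 + n <= l, k < l & l < k + n], E k l, last u p = ed k l,
    drops u p + 2 = k %/ n + l %/ n & rep s n_ge3 (u.1 + n) (u.2 + n) k l q /\ eqv u p q].
Proof.
move=> eu wu; have lt := is_edge_lt eu; have := ltn_ord u.2 => lt2.
have eE : ed (u.1 + n) (u.2 + n) = u by apply: ed_lift1.
have := @walk_rep n s n_ge3 sP (u.1 + n) (u.2 + n) p; rewrite /is_pedge eE.
case=> // [|||k [l [q [b Ekl [_ e d] r ev]]]]; try by lia.
exists k, l, q; split=> //; first by rewrite -e eE.
by rewrite -d eE !ord_div1; lia.
Qed.

Lemma walk_last_edge u p : is_edge s u -> walk s u p -> is_edge s (last u p).
Proof. by move=> eu /(walk_lift eu)[k [l [q [_ h ->]]]]. Qed.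

Lemma expo_le_drops u p : is_edge s u -> walk s u p -> expo u (last u p) <= drops u p.
Proof.
move=> eu wu; have ev := is_edge_lt (walk_last_edge eu wu).
have [k [l [q [[h1 h2 kl lk] _ e d _]]]] := walk_lift eu wu.
have [r [[ek el]|[ek el]]] := liftP kl lk ev (esym e); subst k l; rewrite !ord_div in d;
  rewrite /expo; move: (ltn_ord u.1) (ltn_ord u.2) (ltn_ord (last u p).1) (ltn_ord (last u p).2);
  case: r h1 h2 d {kl lk e} => [|[|r]]; rewrite ?mul0n ?mulSn; repeat case: ifP; lia.
Qed.

Lemma walk_exists u v w : is_edge s u -> is_edge s v -> expo u v <= w ->
  exists p, [/\ walk s u p, last u p = v & drops u p = w].
Proof.
move=> eu ev uvw; have ltu := is_edge_lt eu; have ltv := is_edge_lt ev.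
have eE : ed (u.1 + n) (u.2 + n) = u by apply: ed_lift1.
suff [k [l [b [kl lk Ekl d]]]] : exists k l, [/\ u.1 + n <= k & u.2 + n <= l] /\
    [/\ k < l, l < k + n, ed k l = v & k %/ n + l %/ n = w.+2].
  have lt2 := ltn_ord u.2.
  have [||||||||q r] := @rep_exists n s n_ge3 sP (u.1 + n) (u.2 + n) k l;
    rewrite /is_pedge ?eE ?Ekl //; try by [lia|case: b].
  have [|||||||w1 e1 d1] := rep_lifts sP _ _ _ _ _ _ _ r;
    rewrite /is_pedge ?eE ?Ekl //; try by lia.
  exists q; rewrite eE in w1 e1 d1; split=> //; first by rewrite e1.
  by move: d1; rewrite d !ord_div1; lia.
(* The quotient sum wanted is [w.+2]. Translates of [(v.1, v.2)] have even sums and those of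
   [(v.2, v.1 + n)] odd ones, so the parity of [w] selects the lift. *)
have hw : w = odd w + w./2.*2 by rewrite odd_double_half.
move: (ltn_ord u.1) (ltn_ord u.2) (ltn_ord v.1) (ltn_ord v.2) uvw hw => l1 l2 l3 l4 uvw.
case: (odd w) => hw.
  exists (v.2 + (w./2).+1 * n), (v.1 + (w./2).+2 * n).
  rewrite ed_lift_swap // !ord_div; split; last by split=> //; rewrite ?mulSn; lia.
  by move: uvw; rewrite /expo; repeat case: ifP; case: (w./2) hw => [|h] hw;
    rewrite !mulSn; split; lia.
exists (v.1 + (w./2).+1 * n), (v.2 + (w./2).+1 * n).
rewrite ed_lift // !ord_div; split; last by split=> //; rewrite ?mulSn; lia.
by move: uvw; rewrite /expo; repeat case: ifP; case: (w./2) hw => [|h] hw;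
    rewrite !mulSn; split; lia.
Qed.

(** The quotient sum of the final lift is the number of drops plus 2, and its parity tells the kind
    of lift. Thus both walks end at the same lift, where normal forms are congruent. *)
Lemma eqv_of_drops u p q : is_edge s u -> walk s u p -> walk s u q ->
  last u p = last u q -> drops u p = drops u q -> eqv u p q.
Proof.
move=> eu wp wq epq dpq; have ltu := is_edge_lt eu.
have eE : ed (u.1 + n) (u.2 + n) = u by apply: ed_lift1.
have ltv := is_edge_lt (walk_last_edge eu wp).
have [k [l [p' [[h1 h2 kl lk] Ekl e d [rp ep]]]]] := walk_lift eu wp.
have [k' [l' [q' [[h1' h2' kl' lk'] Ekl' e' d' [rq eq]]]]] := walk_lift eu wq.
have [ek el] : k = k' /\ l = l'.
  move: d' e'; rewrite -epq -dpq => d' e'.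
  have [r hr] := liftP kl lk ltv (esym e); have [r' hr'] := liftP kl' lk' ltv (esym e').
  case: hr hr' => -[? ?] [] [? ?]; subst; rewrite !ord_div in d d'.
  - by have -> : r = r' by lia.
  - by lia.
  - by lia.
  - by have -> : r = r' by lia.
subst k' l'; apply: eqv_trans ep _; apply: eqv_trans (eqv_sym eq).
have lt2 := ltn_ord u.2.
have := rep_uniq sP _ _ _ kl lk _ Ekl rp rq; rewrite /is_pedge eE; apply=> //; lia.
Qed.

End WalksByDrops.

(** * From congruent walks to differences in the ideal *)

Section PathAlgebra.
Variables (K : fieldType) (n : nat) (s : {set 'I_n * 'I_n}).
Local Open Scope ring_scope.
Local Notation node := ('I_n * 'I_n)%type.

Definition qp (u : node) (p : seq node) : qpath n := (u, arr u p).

Lemma tgt_qp u p : tgt (qp u p) = last u p.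
Proof. by rewrite /tgt /= arr_snd. Qed.

Lemma mulp_qp u p q : mulp (qp u p) (qp (last u p) q) = qp u (p ++ q).
Proof. by rewrite /mulp /qp /= arr_cat. Qed.

Lemma valid_qp u p : valid s (qp u p) = is_edge s u && walk s u p.
Proof.
rewrite /valid /= arr_fst arr_snd eqxx andbT; congr (_ && _).
by elim: p u => //= v p IH u; rewrite IH.
Qed.

Lemma valid_inv x : valid s x -> exists2 p, x = qp x.1 p & is_edge s x.1 && walk s x.1 p.
Proof.
move=> vx; have xE : x = qp x.1 [seq y.2 | y <- x.2].
  case/and3P: vx => _ _ /eqP e; case: x e => u r /= e; congr (_, _).
  rewrite -[LHS]zip_unzip -[RHS]zip_unzip; congr zip; last by rewrite /unzip2 arr_snd.
  by rewrite /unzip1 arr_fst.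
by exists [seq y.2 | y <- x.2] => //; rewrite -valid_qp -xE.
Qed.

Lemma coef_cat (c d : comb n K) p : coef (c ++ d) p = coef c p + coef d p.
Proof. exact: big_cat. Qed.

Definition scalec (k : K) (c : comb n K) : comb n K := [seq (k * x.1, x.2) | x <- c].

Lemma coef_scalec k c p : coef (scalec k c) p = k * coef c p.
Proof. by rewrite /coef big_map mulr_sumr. Qed.

Lemma inJ_ext (c d : comb n K) : coef c =1 coef d -> inJ s c -> inJ s d.
Proof. by move=> cd [g [gv gc]]; exists g; split=> // p; rewrite -cd gc. Qed.

Lemma inJ_nil : inJ s ([::] : comb n K).
Proof. by exists [::]. Qed.

Lemma inJ_cat (c d : comb n K) : inJ s c -> inJ s d -> inJ s (c ++ d).
Proof.
move=> [g [gv gc]] [h [hv hc]]; exists (g ++ h); rewrite all_cat gv hv; split=> // p.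
by rewrite map_cat flatten_cat !coef_cat gc hc.
Qed.

Lemma mulc_scalel k (c d : comb n K) : mulc (scalec k c) d = scalec k (mulc c d).
Proof.
rewrite /mulc /scalec map_flatten -!map_comp; congr flatten; apply: eq_map => x /=.
by rewrite -map_comp; apply: eq_map => y /=; rewrite mulrA.
Qed.

Lemma inJ_scale k (c : comb n K) : inJ s c -> inJ s (scalec k c).
Proof.
move=> [g [gv gc]]; exists [seq (k * t.1.1.1, t.1.1.2, t.1.2, t.2) | t <- g].
split; first by rewrite all_map; apply: sub_all gv => -[[[c' p] a] q].
move=> p; rewrite coef_scalec gc -coef_scalec; congr (coef _ p).
rewrite /scalec map_flatten -!map_comp; congr flatten; apply: eq_map => t /=.
by rewrite -/(scalec k _) -!mulc_scalel.
Qed.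

Definition diffc (p q : qpath n) : comb n K := [:: (1, p); (-1, q)].

Lemma coef_diffc p q x : coef (diffc p q) x = (p == x)%:R - (q == x)%:R.
Proof.
rewrite /coef /diffc !big_cons big_nil /=.
by case: (p == x); case: (q == x); rewrite /= ?mulr1n ?mulr0n ?addr0 ?sub0r ?subr0 ?oppr0.
Qed.

Lemma inJ_diffc_refl p : inJ s (diffc p p).
Proof. by apply: inJ_ext inJ_nil => x; rewrite coef_diffc subrr /coef big_nil. Qed.

Lemma inJ_diffc_sym p q : inJ s (diffc p q) -> inJ s (diffc q p).
Proof.
move/(inJ_scale (-1)); apply: inJ_ext => x.
by rewrite coef_scalec !coef_diffc mulN1r opprB.
Qed.

Lemma inJ_diffc_trans p q r : inJ s (diffc p q) -> inJ s (diffc q r) -> inJ s (diffc p r).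
Proof.
move=> h1 h2; apply: inJ_ext (inJ_cat h1 h2) => x.
by rewrite coef_cat !coef_diffc addrA subrK.
Qed.

Lemma tgt_mulp (p q : qpath n) : tgt p = q.1 -> tgt (mulp p q) = tgt q.
Proof. by rewrite /tgt /= map_cat last_cat => ->. Qed.

Lemma mulc_diffc p q q' r : tgt p = q.1 -> tgt p = q'.1 -> tgt q = r.1 -> tgt q' = r.1 ->
  mulc (mulc [:: (1, p)] (diffc q q')) [:: (1, r)] =
  diffc (mulp (mulp p q) r) (mulp (mulp p q') r).
Proof.
move=> e1 e2 e3 e4; rewrite /mulc /= -{1}e1 -e2 !eqxx /=.
by rewrite !tgt_mulp // e3 e4 !eqxx /= !mulr1 !mul1r.
Qed.

Hypothesis n_ge3 : (2 < n)%N.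
Hypothesis sP : triangulation s.
Local Notation vx := (pvertex n_ge3).
Local Notation ed := (pedge n_ge3).
Local Notation E := (is_pedge s n_ge3).
Local Notation fan := (fan s n_ge3).
Local Notation hop := (hop s n_ge3).
Local Notation eqv := (eqv s n_ge3).

Lemma has_diag_inv m : has_diag s (vx m) -> exists t, [/\ m.+1 < t, t.+1 < m + n & E m t]%N.
Proof.
case/existsP=> d /andP[ds dm]; have [sd _ _] := sP; have dd := sd _ ds.
have lt : (d.1 < d.2)%N by case/andP: dd.
have [v dv] : exists v, d = seg (vx m) v.
  by case/orP: dm => /eqP <-; [exists d.2|exists d.1; rewrite segC];
    rewrite /seg lt -surjective_pairing.
have [t ht vt] := exists_lift n_ge3 m v; subst v; exists t.
have tm : t != m.
  by apply: contraTneq lt => tm; move: dv; rewrite tm /seg ltnn => ->; rewrite ltnn.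
have Emt : E m t by rewrite /is_pedge /is_edge /pedge -dv ds orbT.
have : ~~ is_side (ed m t) by rewrite /pedge -dv /is_side lt; case/andP: dd.
by rewrite side_ed; [split=> //; lia|lia].
Qed.

Lemma inJ_triangle u pre j m k post :
  (j < m)%N -> (m < k)%N -> (k < j + n)%N -> E j m -> E m k -> E j k ->
  is_edge s u -> walk s u pre -> last u pre = ed j m -> walk s (ed m k) post ->
  inJ s (diffc (qp u (pre ++ [:: ed j k; ed m k] ++ post))
               (qp u (pre ++ (fan m j m.-1 ++ hop m ++ fan m m.+1 k) ++ post))).
Proof.
move=> jm mk kj.
have [m0 hk hj] : [/\ 0 < m, m < k < m + n & m < j + n < m + n]%N by split; lia.
move=> Ejm Emk Ejk eu wpre epre wpost.
have e2 : last (ed j m) (fan m j m.-1 ++ hop m ++ fan m m.+1 k) = ed m k.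
  by rewrite !last_cat hop_last fan_last.
(* At a corner without a diagonal the triangle is cut off by [(m.-1, m.+1)], and the definition of
   [hop] makes both sides the same path. *)
have [hd|nhd] := boolP (has_diag s (vx m)); last first.
  have kE : k = m.+1.
    by apply: contraNeq nhd => h; apply: (has_diagP _ _ Emk); lia.
  have jE : j = m.-1.
    apply: contraNeq nhd => h; have Emj : E m (j + n) by rewrite EDr EC.
    by apply: (has_diagP _ _ Emj); lia.
  rewrite kE jE !fan_nil /hop (negbTE nhd) cats0 cat0s.
  have -> : ed (m + n).-1 m.+1 = ed m.-1 m.+1.
    by have -> : (m + n).-1 = (m.-1 + n)%N by [lia]; rewrite edDl.
  exact: inJ_diffc_refl.
exists [:: (1, qp u pre, (ed m k, ed j m), qp (ed m k) post)]; split.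
  rewrite /= !valid_qp eu wpre wpost [is_edge _ _]Emk /= andbT.
  have [Emj Ekj] : E m (j + n) /\ E k (j + n) by rewrite !EDr; split; rewrite EC.
  have arrow_a : arrow s (ed m k, ed j m).
    by rewrite (edC _ j) -(edDr _ m j); apply: arrow_int => //; lia.
  rewrite /eligible arrow_a /= -negb_and (edC _ j) -(edDr _ m j) !side_ed //.
  (* Were both edges sides, [(j, k)] would cut off the corner [m] and cross the diagonal ending
     there. *)
  apply/negP => sides; have [t [mt tm Emt]] := has_diag_inv hd.
  have [kE jE] : (k = m.+1 /\ m = j.+1)%N by move: sides; clear -jm mk kj; lia.
  by apply: (@noncross _ _ n_ge3 sP j m k t) => //; rewrite ?kE //; clear -jE tm; lia.
have := @potential_derivative n s n_ge3 sP K j m k jm mk kj Ejm Emk Ejk hd.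
rewrite -[RHS]/(diffc (qp _ _) (qp _ _)) => dWE.
have mulE q : last (ed j m) q = ed m k ->
    mulp (mulp (qp u pre) (qp (ed j m) q)) (qp (ed m k) post) = qp u (pre ++ q ++ post).
  by move=> <-; rewrite -epre mulp_qp -last_cat mulp_qp catA.
move=> p; rewrite /= cats0 dWE mulc_diffc ?tgt_qp ?epre //; first by rewrite !mulE.
Qed.

(** The context [pre], [post] matches the closure of [eqv] under extension at either end with the
    two-sidedness of the ideal. *)
Lemma inJ_eqv w pre u p q post : eqv u p q -> is_edge s w -> last w pre = u ->
  walk s w (pre ++ p ++ post) -> inJ s (diffc (qp w (pre ++ p ++ post)) (qp w (pre ++ q ++ post))).
Proof.
move=> e ew; elim: e pre post => {u p q}.
- by move=> u p pre post *; apply: inJ_diffc_refl.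
- move=> u p q e IH pre post lw wq; apply/inJ_diffc_sym/IH => //.
  have [w1 l1 _] := eqv_walk sP e; move: wq; rewrite /walk !cat_path lw.
  by rewrite -!/(walk _ _ _) w1 l1.
- move=> u p q r e1 IH1 e2 IH2 pre post lw wp; apply: inJ_diffc_trans (IH1 _ _ lw wp) _.
  apply: IH2 => //; have [w1 l1 _] := eqv_walk sP e1; move: wp; rewrite /walk !cat_path lw.
  by rewrite -!/(walk _ _ _) w1 l1.
- move=> u v p q _ IH pre post lw wp.
  by have := IH (rcons pre v) post (last_rcons _ _ _); rewrite !cat_rcons; apply.
- move=> u p q r _ IH pre post lw wp.
  by move: wp; rewrite -!(catA _ r); apply: IH.
- move=> j m k jm mk kj Ejm Emk Ejk pre post lw wp.
  move: (wp); rewrite /walk !cat_path lw => /and3P[w1 _ w2].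
  exact: inJ_triangle.
Qed.

End PathAlgebra.

(** * The representation by monomial matrix units *)

Section TiledOrder.
Variables (K : fieldType) (n : nat) (s : {set 'I_n * 'I_n}).
Hypothesis n_ge3 : 2 < n.
Hypothesis sP : triangulation s.
Local Open Scope ring_scope.
Local Notation node := ('I_n * 'I_n)%type.
Local Notation m := #|[pred v : node | is_edge s v]|.
Local Notation frac k := (tofrac (k%:P) : Kx K).

Definition edge_at (i : 'I_m) : node := enum_val i.

Lemma edge_atP i : is_edge s (edge_at i).
Proof. exact: (enum_valP i). Qed.

Lemma edge_at_inj : injective edge_at.
Proof. exact: enum_val_inj. Qed.

Lemma edge_at_onto v : is_edge s v -> exists i, v = edge_at i.
Proof. by move=> ev; exists (enum_rank_in ev v); rewrite /edge_at enum_rankK_in. Qed.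

Definition qdrops (p : qpath n) : nat := drops p.1 [seq x.2 | x <- p.2].

Lemma qdrops_qp u p : qdrops (qp u p) = drops u p.
Proof. by rewrite /qdrops /= arr_snd. Qed.

Lemma qdrops_mulp (p q : qpath n) : tgt p = q.1 -> qdrops (mulp p q) = (qdrops p + qdrops q)%N.
Proof. by rewrite /tgt /qdrops /= map_cat drops_cat => ->. Qed.

Definition psi (p : qpath n) : 'M[Kx K]_m :=
  \matrix_(i, j) (if (p.1 == edge_at i) && (tgt p == edge_at j) then xF K ^+ qdrops p else 0).

Definition exponent (i j : 'I_m) : int := (expo (edge_at i) (edge_at j))%:Z.

Lemma psi_delta i j p : p.1 = edge_at i -> tgt p = edge_at j ->
  psi p = xF K ^+ qdrops p *: delta_mx i j.
Proof.
move=> e1 e2; apply/matrixP => i' j'; rewrite !mxE e1 e2 !(inj_eq edge_at_inj).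
by rewrite !(eq_sym _ i') !(eq_sym _ j'); case: ifP => _; rewrite ?mulr1 ?mulr0.
Qed.

Lemma psi_eq p q : p.1 = q.1 -> tgt p = tgt q -> qdrops p = qdrops q -> psi p = psi q.
Proof. by rewrite /psi => -> -> ->. Qed.

Lemma valid_ends p : valid s p -> is_edge s p.1 /\ is_edge s (tgt p).
Proof.
case/valid_inv => w -> /andP[/= e1 wk]; rewrite tgt_qp; split=> //.
exact: walk_last_edge wk.
Qed.

Lemma valid_delta p : valid s p -> exists i j,
  [/\ p.1 = edge_at i, tgt p = edge_at j & psi p = xF K ^+ qdrops p *: delta_mx i j].
Proof.
case/valid_ends => /edge_at_onto[i ei] /edge_at_onto[j ej].
by exists i, j; rewrite (psi_delta ei ej).
Qed.

Lemma psi_mul p q : valid s p -> valid s q ->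
  psi p *m psi q = if tgt p == q.1 then psi (mulp p q) else 0.
Proof.
move=> /valid_delta[i [j [e1 e2 ->]]] /valid_delta[k [l [e3 e4 ->]]].
rewrite -scalemxAl -scalemxAr scalerA mul_delta_mx_cond e2 e3 (inj_eq edge_at_inj).
case: eqP => [jk|_]; last by rewrite mulr0n scaler0.
rewrite mulr1n (@psi_delta i l); rewrite ?tgt_mulp ?qdrops_mulp ?exprD ?e2 ?e3 ?jk //.
Qed.

Lemma psi_one : \sum_(v | is_edge s v) psi (v, [::]) = 1%:M.
Proof.
apply/matrixP => i j; rewrite summxE mxE (bigD1 (edge_at i)) ?edge_atP //=.
rewrite mxE /tgt /= eqxx (inj_eq edge_at_inj) big1 ?addr0 => [|v /andP[_ vi]].
  by case: eqP.
by rewrite mxE (negbTE vi).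
Qed.

Lemma psi_in_tiled p : valid s p -> in_tiled exponent (psi p).
Proof.
move=> vp i j; rewrite mxE; case: ifP => [/andP[/eqP e1 /eqP e2]|_]; last first.
  by exists 0; rewrite rmorph0 mulr0.
exists 'X^(qdrops p - expo (edge_at i) (edge_at j)).
rewrite rmorphXn -exprnP -exprD subnKC // -e1 -e2.
case/valid_inv: vp => w -> /andP[/= eu wk]; rewrite tgt_qp qdrops_qp.
exact: (expo_le_drops n_ge3 sP eu wk).
Qed.

Lemma expo_refl (u : node) : expo u u = 0%N.
Proof. by rewrite /expo !leqnn. Qed.

Lemma exponent_tiled : tiled_order K exponent.
Proof.
split=> [i j t|i j]; last first.
  rewrite mxE; case: eqP => [->|_]; last by exists 0; rewrite rmorph0 mulr0.
  by exists 1; rewrite /exponent expo_refl expr0z rmorph1 mulr1.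
(* Walks attaining the two minimal exponents are concatenated; the drops of the result bound the
   third exponent. *)
have [p [wp ep dp]] := walk_exists n_ge3 sP (edge_atP i) (edge_atP j) (leqnn _).
have [q [wq eq dq]] := walk_exists n_ge3 sP (edge_atP j) (edge_atP t) (leqnn _).
have := @expo_le_drops n s n_ge3 sP _ (p ++ q) (edge_atP i).
rewrite last_cat ep eq drops_cat ep dp dq /exponent -PoszD lez_nat; apply.
by rewrite /walk cat_path ep; apply/andP.
Qed.

Lemma linext_cat (c d : comb n K) : linext psi (c ++ d) = linext psi c + linext psi d.
Proof. exact: big_cat. Qed.

Lemma linext_scale k (c : comb n K) : linext psi (scalec k c) = frac k *: linext psi c.
Proof.
rewrite /linext big_map scaler_sumr; apply: eq_bigr => x _ /=.
by rewrite scalerA -rmorphM /= polyCM.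
Qed.

(** Membership in the ideal sees a combination only through [coef]; regrouping by paths shows the
    same for [linext]. *)
Lemma linext_coef (r : seq (qpath n)) (c : comb n K) :
  uniq r -> {subset [seq x.2 | x <- c] <= r} ->
  linext psi c = \sum_(p <- r) frac (coef c p) *: psi p.
Proof.
move=> ur sub; transitivity
    (\sum_(p <- r) \sum_(x <- c | x.2 == p) frac x.1 *: psi x.2); last first.
  apply: eq_bigr => p _; rewrite /coef !rmorph_sum /= scaler_suml.
  by apply: eq_bigr => x /eqP ->.
rewrite (exchange_big_dep xpredT) //= /linext big_seq [RHS]big_seq.
apply: eq_bigr => x xc.
rewrite big_mkcond (bigD1_seq x.2) ?sub ?map_f //= eqxx big1 ?addr0 // => p.
by rewrite eq_sym => /negbTE ->.
Qed.

Lemma linext_ext (c d : comb n K) : coef c =1 coef d -> linext psi c = linext psi d.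
Proof.
move=> cd; pose r := undup [seq x.2 | x <- c ++ d].
rewrite !(@linext_coef r) ?undup_uniq //; first by apply: eq_bigr => p _; rewrite cd.
  by move=> x xd; rewrite mem_undup map_cat mem_cat xd orbT.
by move=> x xc; rewrite mem_undup map_cat mem_cat xc.
Qed.

(** A generator is a difference of two paths with the same ends and drops, on which [psi] agrees;
    products that do not compose are empty combinations. *)
Lemma linext_inJ (c : comb n K) : inJ s c -> linext psi c = 0.
Proof.
move=> [g [/allP gv gc]]; rewrite (linext_ext gc) /linext big_flatten big_map big_seq.
rewrite big1 // => -[[[k p] a] r] /gv /and3P[/= _ el _].
rewrite -/(linext psi _).
have [j [l [t [[jl lt tj] [Ejl Elt Ejt] hd ->]]]] := eligible_triangle n_ge3 sP el.
pose A := qp (pedge n_ge3 j l) [:: pedge n_ge3 j t; pedge n_ge3 l t].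
pose B := qp (pedge n_ge3 j l) (fan s n_ge3 l j l.-1 ++ hop s n_ge3 l ++ fan s n_ge3 l l.+1 t).
rewrite (_ : dW s K _ = diffc K A B); last exact: potential_derivative.
have [_ lAB dAB] := eqv_walk sP (eqv_tri jl lt tj Ejl Elt Ejt).
have tAB : tgt A = tgt B by rewrite !tgt_qp.
have -> : [:: (k, p)] = scalec k [:: (1, p)] by rewrite /scalec /= mulr1.
rewrite !mulc_scalel linext_scale.
have [eA|nA] := eqVneq (tgt p) A.1; last first.
  by rewrite /mulc /= (negbTE nA) /= /linext big_nil scaler0.
have [eR|nR] := eqVneq (tgt A) r.1; last first.
  rewrite /mulc /= eA eqxx /= !tgt_mulp // -tAB (negbTE nR) /= /linext big_nil scaler0 //.
rewrite mulc_diffc -?tAB // /linext !big_cons big_nil /=.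
rewrite (@psi_eq _ (mulp (mulp p B) r)).
- by rewrite !rmorphN !rmorph1 scaleN1r scale1r addr0 subrr scaler0.
- by [].
- by rewrite !tgt_mulp // -?tAB.
- by rewrite !qdrops_mulp ?tgt_mulp // -?tAB // !qdrops_qp dAB.
Qed.

Lemma psi_onto (M : 'M[Kx K]_m) : in_tiled exponent M ->
  exists c : comb n K, all (fun x => valid s x.2) c /\ M = linext psi c.
Proof.
pose S (A : 'M[Kx K]_m) := exists c : comb n K, all (fun x => valid s x.2) c /\ A = linext psi c.
have S0 : S 0 by exists [::]; rewrite /linext big_nil.
have SD A B : S A -> S B -> S (A + B).
  move=> [c [vc ->]] [d [vd ->]]; exists (c ++ d).
  by rewrite all_cat vc vd linext_cat.
move=> tM; rewrite -/(S M) [M]matrix_sum_delta.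
apply: big_ind => // i _; apply: big_ind => // j _.
have [r ->] := tM i j; rewrite -[r in tofrac r]coefK poly_def rmorph_sum /= mulr_sumr scaler_suml.
apply: big_ind => // k _.
(* The monomial of degree [k] in [r] is realised by a walk with [k] drops more than the minimum. *)
have [p [wp ep dp]] := walk_exists n_ge3 sP (edge_atP i) (edge_atP j) (leq_addr k _).
exists [:: (r`_k, qp (edge_at i) p)]; rewrite /= valid_qp edge_atP wp; split=> //.
rewrite /linext big_seq1 (@psi_delta i j) ?tgt_qp // qdrops_qp dp scalerA.
by rewrite -mul_polyC rmorphM rmorphXn /= exprD /exponent -exprnP mulrCA.
Qed.

Definition same_class (p : qpath n) : pred (seq node) :=
  fun q => [&& walk s p.1 q, last p.1 q == tgt p & drops p.1 q == qdrops p].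

(** [choose] depends only on the predicate once it is satisfied, so valid paths with the same ends
    and drops receive literally the same representative. *)
Definition canon (p : qpath n) : qpath n :=
  qp p.1 (choose (same_class p) [seq x.2 | x <- p.2]).

Lemma same_class_refl p : valid s p -> same_class p [seq x.2 | x <- p.2].
Proof.
case/valid_inv => w -> /andP[_ wk]; rewrite /same_class /= arr_snd tgt_qp qdrops_qp.
by rewrite wk !eqxx.
Qed.

Lemma canonP p : valid s p -> [/\ walk s p.1 [seq x.2 | x <- (canon p).2],
  tgt (canon p) = tgt p & qdrops (canon p) = qdrops p].
Proof.
move/same_class_refl/chooseP => /and3P[h1 /eqP h2 /eqP h3].
by rewrite tgt_qp qdrops_qp /canon /= arr_snd.
Qed.

Lemma canon_eq p q : valid s p -> valid s q ->
  (canon p == canon q) = [&& p.1 == q.1, tgt p == tgt q & qdrops p == qdrops q].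
Proof.
move=> vp vq; have [_ t1 d1] := canonP vp; have [_ t2 d2] := canonP vq.
apply/eqP/and3P => [e|[/eqP e1 /eqP e2 /eqP e3]].
  by rewrite -t1 -d1 e t2 d2 !eqxx; have := congr1 fst e; rewrite /= => ->.
have ec : same_class p = same_class q by rewrite /same_class e1 e2 e3.
have := same_class_refl vp; rewrite /canon ec e1 => h.
by congr qp; apply: choose_id => //; apply: same_class_refl.
Qed.

Lemma inJ_canon p : valid s p -> inJ s (diffc K p (canon p)).
Proof.
move=> vp; have /chooseP /and3P[h1 /eqP h2 /eqP h3] := same_class_refl vp.
rewrite /canon; set w2 := choose _ _ in h1 h2 h3 *.
case/valid_inv: (vp) => w ep /andP[eu wk].
have ev : eqv s n_ge3 p.1 w w2.
  by apply: eqv_of_drops; rewrite // ?h2 ?h3 ep ?tgt_qp ?qdrops_qp.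
have := @inJ_eqv K n s n_ge3 sP p.1 [::] p.1 w w2 [::] ev eu.
by rewrite /= !cats0 -ep; apply.
Qed.

Lemma coef_cons k p (c : comb n K) q : coef ((k, p) :: c) q = k * (p == q)%:R + coef c q.
Proof. by rewrite /coef big_cons /=; case: eqP; rewrite ?mulr1 // mulr0 add0r. Qed.

Lemma inJ_canon_comb (c : comb n K) : all (fun x => valid s x.2) c ->
  inJ s (c ++ scalec (-1) [seq (x.1, canon x.2) | x <- c]).
Proof.
elim: c => [|[k p] c IH] /=; first by move=> _; apply: inJ_nil.
move=> /andP[vp /IH h]; apply: inJ_ext (inJ_cat (inJ_scale k (inJ_canon vp)) h) => q.
rewrite -cat_cons !coef_cat !coef_scalec coef_diffc /= !coef_cons mulrBr !mulN1r.
by rewrite coef_scalec mulN1r mulNr addrACA.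
Qed.

Lemma linext_entry (c : comb n K) i j : linext psi c i j =
  tofrac (\sum_(x <- c | (x.2.1 == edge_at i) && (tgt x.2 == edge_at j))
            x.1 *: 'X^(qdrops x.2)).
Proof.
rewrite /linext summxE rmorph_sum /= [RHS]big_mkcond /=; apply: eq_bigr => x _.
rewrite !mxE; case: ifP => _; last by rewrite mulr0.
by rewrite -mul_polyC rmorphM rmorphXn.
Qed.

(** Representatives are separated by their ends and drops, so the coefficient of one of them is the
    coefficient of one power of x in one matrix entry. *)
Lemma coef_canon0 (c : comb n K) q : all (fun x => valid s x.2) c -> linext psi c = 0 ->
  coef [seq (x.1, canon x.2) | x <- c] q = 0.
Proof.
move=> /allP vc c0; rewrite /coef big_map /=.
have [/hasP[x0 x0c /eqP <-]|/hasPn nc] := boolP (has (fun x => canon x.2 == q) c); last first.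
  by rewrite big_seq_cond big1 // => x /andP[/nc /negbTE ->].
have v0 := vc _ x0c; have [i [j [ei ej _]]] := valid_delta v0.
have := linext_entry c i j; rewrite c0 mxE => /esym/eqP; rewrite tofrac_eq0 => /eqP.
move/(congr1 (fun r : {poly K} => r`_(qdrops x0.2))); rewrite coef0 => h; rewrite -[RHS]h {h}.
rewrite coef_sum -ei -ej big_seq_cond [RHS]big_seq_cond.
rewrite [LHS]big_mkcond [RHS]big_mkcond; apply: eq_bigr => x _.
have [xc|] //= := boolP (x \in c).
rewrite canon_eq ?vc // coefZ coefXn (eq_sym (qdrops x0.2)) andbA.
by case: (_ && (tgt _ == _)); case: (qdrops _ == _); rewrite /= ?mulr1 ?mulr0.
Qed.

Lemma linext_eq0 (c : comb n K) : all (fun x => valid s x.2) c ->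
  linext psi c = 0 <-> inJ s c.
Proof.
move=> vc; split; last exact: linext_inJ.
move=> c0; apply: inJ_ext (inJ_canon_comb vc) => q.
by rewrite coef_cat coef_scalec coef_canon0 // mulr0 addr0.
Qed.

End TiledOrder.

Local Open Scope ring_scope.

(** The isomorphism is stated on the path algebra: a linear, multiplicative, unital map onto the
    tiled order with kernel J. The R-algebra structure on the quotient is the one transported from
    the order. *)
Theorem theorem2p9 (K : fieldType) (n : nat) (s : {set 'I_n * 'I_n}) :
  (3 <= n)%N -> triangulation s ->
  exists (m : nat) (a : 'I_m -> 'I_m -> int) (psi : qpath n -> 'M[Kx K]_m),
    [/\ tiled_order K a,
        (forall p, valid s p -> in_tiled a (psi p)),
        ((forall p q, valid s p -> valid s q ->
           psi p *m psi q = if tgt p == q.1 then psi (mulp p q) else 0) /\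
        \sum_(v | is_edge s v) psi (v, [::]) = 1%:M),
        (forall M, in_tiled a M ->
           exists c : comb n K, all (fun x => valid s x.2) c /\ M = linext psi c) &
        (forall c : comb n K, all (fun x => valid s x.2) c ->
           (linext psi c = 0 <-> inJ s c))].
Proof.
move=> n_ge3 sP; exists #|[pred v : 'I_n * 'I_n | is_edge s v]|, (@exponent n s), (@psi K n s).
split.
- exact: exponent_tiled.
- exact: psi_in_tiled.
- split; [exact: psi_mul|exact: psi_one].
- exact: psi_onto.
- exact: linext_eq0.
Qed.
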